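(* Let $n\ge 5$ and $6\le k\le 2n$ be integers, and let $r$ be the remainder of $n-1$ divided by $k$. Then $$\kappa(B_n;C_k)=\begin{cases}2\left\lceil\dfrac{n-1}{k}\right\rceil-1, & \text{if } \left(6\le k\le n-1 \text{ and } 1\le r\le \lfloor\frac{k}{2}\rfloor-1\right) \text{ or } k=2n,\\[2mm] 3, & \text{if } k=n,\\[1mm] 2\left\lceil\dfrac{n-1}{k}\right\rceil, & \text{otherwise.}\end{cases}$$
   Context: All graphs are finite and simple. $C_k$ is the cycle with $k$ vertices. Structure connectivity. For a set $\mathcal{F}$ of subgraphs of a connected graph $G$ (no disjointness is required), let $V(\mathcal{F})$ be the union of the vertex sets of its members and $G-\mathcal{F}=G-V(\mathcal{F})$. $\mathcal{F}$ is a subgraph cut of $G$ if $G-\mathcal{F}$ is disconnected or is a trivial graph (a single vertex). For a connected graph $H$, an $H$-structure cut is a subgraph cut each of whose members is isomorphic to $H$. $\kappa(G;H)$ is the minimum cardinality of an $H$-structure cut of $G$. Crossed cube. Two binary strings $x_1x_0$, $y_1y_0$ are pair related, $x_1x_0\sim y_1y_0$, iff $(x_1x_0,y_1y_0)\in\{(00,00),(10,10),(01,11),(11,01)\}$. $CQ_1=K_2$ with vertices $0,1$. For $n\ge 2$, $CQ_n$ consists of two copies $CQ_{n-1}^0,CQ_{n-1}^1$ of $CQ_{n-1}$ (labels prefixed by $0$ and $1$ respectively), together with an edge between $u=0u_{n-2}\cdots u_0$ and $v=1v_{n-2}\cdots v_0$ iff $u_{n-2}=v_{n-2}$ when $n$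 is even, and $u_{2i+1}u_{2i}\sim v_{2i+1}v_{2i}$ for all $0\le i<\lfloor\frac{n-1}{2}\rfloor$. BCDC network. $B_2$ is the $4$-cycle with vertices $[00,01],[00,10],[01,11],[10,11]$ (two of these being adjacent iff they share an entry). For $n\ge 3$, $B_{n-1}^0$ (resp. $B_{n-1}^1$) is the copy of $B_{n-1}$ obtained by prefixing both entries of each vertex $[x,y]$ with $0$ (resp. $1$), and $B_n$ consists of $B_{n-1}^0$, $B_{n-1}^1$ and the independent set $S_n=\{[a,b]: a\in V(CQ_{n-1}^0), b\in V(CQ_{n-1}^1), (a,b)\in E(CQ_n)\}$, where $[a,b]\in V(B_{n-1}^0)$ is adjacent to $[c,d]\in S_n$ iff $a=c$ or $b=c$, and $[c,d]\in S_n$ is adjacent to $[e,f]\in V(B_{n-1}^1)$ iff $e=d$ or $f=d$ (there are no edges between $B_{n-1}^0$ and $B_{n-1}^1$). Equivalently, $B_n$ is the line graph of $CQ_n$. *)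

(* Defs.v *)
From mathcomp Require Import all_boot.

Set Implicit Arguments.
Unset Strict Implicit.
Unset Printing Implicit Defensive.

Record sgraph := SGraph {
  vertex :> finType;
  adj : rel vertex;
  adj_sym : symmetric adj;
  adj_irr : irreflexive adj }.

Definition edges (G : sgraph) : {set {set G}} :=
  [set [set x; y] | x in G, y in G & adj x y].

(* The graph with no vertices is neither disconnected nor trivial. *)
Definition disconnected (G : sgraph) : Prop :=
  exists x y : G, ~~ connect (@adj G) x y.

Definition trivial_graph (G : sgraph) : Prop := #|G| = 1.

Section Deletion.
Variables (G : sgraph) (U : {set G}).

Definition del_adj : rel {x : G | x \notin U} :=
  fun x y => adj (val x) (val y).

Lemma del_adj_sym : symmetric del_adj.
Proof. by move=> x y; apply: adj_sym. Qed.

Lemma del_adj_irr : irreflexive del_adj.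
Proof. by move=> x; apply: adj_irr. Qed.

Definition del_vertices : sgraph := SGraph del_adj_sym del_adj_irr.

End Deletion.

(* A pair (vertex set, edge set), an edge being the set of its two ends. *)
Definition subgraph (G : sgraph) : finType := ({set G} * {set {set G}})%type.

Definition is_subgraph (G : sgraph) (S : subgraph G) : Prop :=
  forall e, e \in S.2 -> e \in edges G /\ e \subset S.1.

Definition subgraph_iso (G H : sgraph) (S : subgraph G) : Prop :=
  exists f : H -> G,
    [/\ injective f,
        S.1 = [set f x | x in H]
      & forall x y : H, adj x y = ([set f x; f y] \in S.2)].

Definition cover_vertices (G : sgraph) (F : {set subgraph G}) : {set G} :=
  \bigcup_(S in F) S.1.

Definition subgraph_cut (G : sgraph) (F : {set subgraph G}) : Prop :=
  (forall S, S \in F -> is_subgraph S) /\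
  (disconnected (del_vertices (cover_vertices F)) \/
   trivial_graph (del_vertices (cover_vertices F))).

Definition structure_cut (G H : sgraph) (F : {set subgraph G}) : Prop :=
  subgraph_cut F /\ forall S, S \in F -> subgraph_iso H S.

(* kappa(G; H) = m.  This is a relation, not a function, so that no value is
   assigned when G has no H-structure cut. *)
Definition is_structure_connectivity (G H : sgraph) (m : nat) : Prop :=
  (exists2 F : {set subgraph G}, structure_cut H F & #|F| = m) /\
  (forall F : {set subgraph G}, structure_cut H F -> m <= #|F|).

(* C_k for k >= 3; the test i != j only matters for k = 1. *)
Definition cycle_adj (k : nat) : rel 'I_k :=
  fun i j => (i != j) && ((ordS i == j) || (ordS j == i)).

Lemma cycle_adj_sym k : symmetric (@cycle_adj k).
Proof. by move=> i j; rewrite /cycle_adj eq_sym orbC. Qed.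

Lemma cycle_adj_irr k : irreflexive (@cycle_adj k).
Proof. by move=> i; rewrite /cycle_adj eqxx. Qed.

Definition cycle_graph (k : nat) : sgraph :=
  SGraph (@cycle_adj_sym k) (@cycle_adj_irr k).

(* Binary strings u_{n-1} ... u_0, written from left to right: the head of the
   tuple is u_{n-1}, and prefixing a label is consing. *)
Notation bits n := (n.-tuple bool).

Definition bit n (u : bits n) (i : nat) : bool := nth false (rev u) i.

Definition btail n (u : bits n.+1) : bits n := behead_tuple u.

Definition pair_related (x y : bool * bool) : bool :=
  (x, y) \in [:: ((false, false), (false, false));
                 ((true, false), (true, false));
                 ((false, true), (true, true));
                 ((true, true), (false, true))].

(* The condition for u and v, with distinct leading bits, to be joined in CQ_n
   (n >= 2); it involves only the bits u_{n-2}, ..., u_0. *)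
Definition crossed n (u v : bits n) : bool :=
  (~~ odd n ==> (bit u (n - 2) == bit v (n - 2))) &&
  [forall i : 'I_((n - 1) %/ 2),
     pair_related (bit u (2 * i + 1), bit u (2 * i))
                  (bit v (2 * i + 1), bit v (2 * i))].

Fixpoint CQ_adj (n : nat) : rel (bits n) :=
  match n return rel (bits n) with
  | 0 => fun _ _ => false
  | m.+1 => fun u v =>
      if m == 0 then u != v
      else if thead u == thead v then CQ_adj (btail u) (btail v)
      else crossed u v
  end.

Section BCDC.

Definition bits_pair (n : nat) : finType := (bits n * bits n)%type.

Definition ptail n (p : bits_pair n.+1) : bits_pair n :=
  (btail p.1, btail p.2).

(* Both entries of p have prefix b. *)
Definition in_copy n (b : bool) (p : bits_pair n.+1) : bool :=
  (thead p.1 == b) && (thead p.2 == b).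

Definition in_S n (p : bits_pair n.+1) : bool :=
  [&& thead p.1 == false, thead p.2 == true & CQ_adj p.1 p.2].

(* [x, y] is encoded as an ordered pair: in every vertex produced by the
   construction the first entry is the smaller one.  The construction starts at
   B_2; the graph is empty for n < 2. *)
Fixpoint BCDC_vertex (n : nat) : pred (bits_pair n) :=
  match n return pred (bits_pair n) with
  | 0 => fun _ => false
  | m.+1 => fun p =>
      match m with
      | 0 => false
      | 1 => (val p.1, val p.2) \in
               [:: ([:: false; false], [:: false; true]);
                   ([:: false; false], [:: true; false]);
                   ([:: false; true], [:: true; true]);
                   ([:: true; false], [:: true; true])]
      | _ => [|| in_copy false p && BCDC_vertex (ptail p),
                 in_copy true p && BCDC_vertex (ptail p)
               | in_S p]
      end
  end.

Definition share_entry n (p q : bits_pair n) : bool :=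
  [|| p.1 == q.1, p.1 == q.2, p.2 == q.1 | p.2 == q.2].

(* Adjacency between p in one of the two copies and s in S_n. *)
Definition link n (p s : bits_pair n.+1) : bool :=
  in_S s &&
  (in_copy false p && ((p.1 == s.1) || (p.2 == s.1)) ||
   in_copy true p && ((p.1 == s.2) || (p.2 == s.2))).

Fixpoint BCDC_rel (n : nat) : rel (bits_pair n) :=
  match n return rel (bits_pair n) with
  | 0 => fun _ _ => false
  | m.+1 => fun p q =>
      match m with
      | 0 => false
      | 1 => (p != q) && share_entry p q
      | _ =>
        [|| [&& in_copy false p, in_copy false q & BCDC_rel (ptail p) (ptail q)],
            [&& in_copy true p, in_copy true q & BCDC_rel (ptail p) (ptail q)],
            link p q | link q p]
      end
  end.

Variable n : nat.

Definition BCDC_adj : rel {p : bits_pair n | BCDC_vertex p} :=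
  fun p q => BCDC_rel (val p) (val q).

Lemma BCDC_relS m (p q : bits_pair m.+3) :
  BCDC_rel p q =
    [|| [&& in_copy false p, in_copy false q & BCDC_rel (ptail p) (ptail q)],
        [&& in_copy true p, in_copy true q & BCDC_rel (ptail p) (ptail q)],
        link p q | link q p].
Proof. by []. Qed.

Lemma BCDC_rel_sym m : symmetric (@BCDC_rel m).
Proof.
elim: m => [|[|[|m]] IH] // p q.
  rewrite /= eq_sym /share_entry; congr (_ && _).
  rewrite ![q.1 == _]eq_sym ![q.2 == _]eq_sym.
  by congr (_ || _); rewrite orbCA.
rewrite !BCDC_relS IH [link p q || _]orbC.
by rewrite ![in_copy _ p && (in_copy _ q && _)]andbCA.
Qed.

Lemma BCDC_rel_irr m : irreflexive (@BCDC_rel m).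
Proof.
elim: m => [|[|[|m]] IH] // p; first by rewrite /= eqxx.
have linkF : link p p = false.
  by rewrite /link /in_S /in_copy; case: (thead p.1); case: (thead p.2);
    rewrite ?andbF.
by rewrite BCDC_relS IH linkF !andbF.
Qed.

Lemma BCDC_adj_sym : symmetric BCDC_adj.
Proof. by move=> p q; apply: BCDC_rel_sym. Qed.

Lemma BCDC_adj_irr : irreflexive BCDC_adj.
Proof. by move=> p; apply: BCDC_rel_irr. Qed.

Definition BCDC : sgraph := SGraph BCDC_adj_sym BCDC_adj_irr.

End BCDC.

Definition ceil_div (m d : nat) : nat := (m + d.-1) %/ d.

Lemma ceil_divP m d q : 0 < d -> (ceil_div m d <= q) = (m <= q * d).
Proof.
case: d => // d _.
by rewrite /ceil_div -ltnS ltn_divLR // mulSn addnC addSn ltnS leq_add2l.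
Qed.

(* Main.v *)
Require Import Defs.
From mathcomp Require Import all_boot zify.

(** Write CQ for the crossed cube CQ_n.  Its recursive definition says that CQ_(n+1)
    is two copies of CQ_n joined by a perfect matching ([CQ_adj_cons]).  By induction,
    CQ is n-regular and triangle-free, and the vertices of the BCDC network B_n are the
    edges of CQ, two of them being adjacent when they share an end ([BCDC_vertexE],
    [BCDC_relE]).  Deleting vertices of B_n is thus deleting edges of CQ, and what is
    left of B_n is disconnected exactly when what is left of CQ has two components that each
    contain an edge.  An edge e = uv of CQ has as neighbours in B_n the n-1 other edges at
    u and the n-1 other edges at v: two cliques A and B, with no adjacency between them
    because CQ has no triangle.

    Lower bound.  Let U be the set of edges covered by a cut of m cycles C_k, so that
    U has at most k * m elements, and let X be the vertex set of a component that has an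
    edge.  All edges of CQ between X and its complement are in U.  If X and its
    complement both have at least three vertices, there are at least 3n-4 such edges
    ([boundary_ge]), and k * m >= 3n-4 implies the bound ([cycle_number_leq_large]).
    Otherwise X or its complement is the pair of ends of an edge e = uv, and the cycles
    cover A and B and avoid e; this is also the situation when e is all that is left of
    B_n.  Such a cycle is contained in A, or contained in B, or has at least two vertices
    outside A and B ([cycle_trace]): it must leave A on its way to B and on its way back,
    and an edge not at u meets at most one element of A, again because CQ has no triangle.
    Counting gives 2(n-1) <= k(a+b) + (k-2)c, where a, b and c are the numbers of cycles
    of the three kinds; moreover a = b = 0 when k >= n, and A needs k * a >= n-1, as B
    needs k * b >= n-1, when c = 0.  These constraints imply the bound
    ([cycle_number_leq]).

    Upper bound.  It suffices to cover A and B for one well-chosen edge uv by cycles that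
    avoid uv: this vertex of B_n is then isolated, so that the rest of B_n is disconnected
    or trivial.  Any k vertices of the clique A, or of B, form a cycle.  Two further kinds
    of cycles are used.  If u, a_i, b_i, v is a 4-cycle of CQ for i = 1, 2, then a cycle
    can run through any part of A, the edge a_1 b_1, any part of B and the edge a_2 b_2
    ([kcycle_across]): this spends only two vertices outside A and B.  If u, a_0, c, a_1
    is a 4-cycle, then a cycle can run through A and then through edges at c
    ([kcycle_handle]), which realises the lengths from n+1 to 2n-1.  Taking for u the zero
    string and for v the string with only its leading bit set provides all these 4-cycles
    ([ladder_exists]). *)

Set Implicit Arguments.
Unset Strict Implicit.
Unset Printing Implicit Defensive.

(** * The crossed cube as two copies joined by a matching *)

(** Pair-relatedness replaces x1 x0 by (x1 xor x0) x0: every bit of odd position gets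
    xored with the bit to its right.  As position 0 is the last entry of the tuple, the
    entry i has position n.-1 - i. *)
Definition twist n (u : bits n) : bits n :=
  [tuple bit u (n.-1 - i) (+) (odd (n.-1 - i) && bit u (n.-1 - i).-1) | i < n].

Lemma bit_twist n (u : bits n) j : j < n ->
  bit (twist u) j = bit u j (+) (odd j && bit u j.-1).
Proof.
move=> lt_jn; rewrite {1}/bit nth_rev size_tuple //.
have lt_i : n - j.+1 < n by lia.
rewrite -[n - j.+1]/(nat_of_ord (Ordinal lt_i)) -tnth_nth tnth_mktuple /=.
by have -> : n.-1 - (n - j.+1) = j by lia.
Qed.

Lemma eq_bits n (u v : bits n) : (forall j, j < n -> bit u j = bit v j) -> u = v.
Proof.
move=> eq_uv; apply/val_inj/(can_inj revK)/(@eq_from_nth _ false).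
  by rewrite !size_rev !size_tuple.
by move=> j; rewrite size_rev size_tuple; apply: eq_uv.
Qed.

Lemma twistK n : involutive (@twist n).
Proof.
move=> u; apply: eq_bits => j lt_jn; rewrite bit_twist // [bit (twist u) j]bit_twist //.
case oj: (odd j); last by rewrite !addbF.
have [lt_j'n odd_j'] : j.-1 < n /\ odd j.-1 = false by lia.
by rewrite bit_twist // odd_j' addbF addbK.
Qed.

Lemma bit_cons n b (u : bits n) j : j < n -> bit [tuple of b :: u] j = bit u j.
Proof.
by move=> lt_jn; rewrite /bit /= rev_cons nth_rcons size_rev size_tuple lt_jn.
Qed.

Lemma pair_relatedE x1 x0 y1 y0 :
  pair_related (x1, x0) (y1, y0) = (y0 == x0) && (y1 == x1 (+) x0).
Proof. by case: x1; case: x0; case: y1; case: y0. Qed.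

(** For even n.+1 the bit below the leading one is in no pair, but it has an even
    position and [twist] leaves it unchanged, as the first conjunct of [crossed]
    requires. *)
Lemma crossedE n b c (u v : bits n) :
  crossed [tuple of b :: u] [tuple of c :: v] = (v == twist u).
Proof.
rewrite /crossed; apply/andP/eqP => [[top_eq /forallP pairs]|->].
  apply: eq_bits => j lt_jn; rewrite bit_twist //.
  have [lt_i|] := ltnP (j %/ 2) ((n.+1 - 1) %/ 2).
    have [lt1 lt0] : 2 * (j %/ 2) + 1 < n /\ 2 * (j %/ 2) < n by lia.
    have := pairs (Ordinal lt_i); rewrite pair_relatedE !bit_cons //=.
    case/andP=> /eqP eq0 /eqP eq1.
    have [oj|ej] := boolP (odd j); last first.
      have jE : 2 * (j %/ 2) = j by lia.
      by rewrite addbF -jE.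
    have [j1E j0E] : 2 * (j %/ 2) + 1 = j /\ 2 * (j %/ 2) = j.-1 by lia.
    by rewrite -{1}j1E eq1 j1E j0E.
  move=> le_ij; have ej : ~~ odd n.+1 by lia.
  have jE : n.+1 - 2 = j by lia.
  have oj : odd j = false by lia.
  by have := implyP top_eq ej; rewrite jE !bit_cons // oj addbF => /eqP.
split.
  apply/implyP => en.
  have [lt_n o_n] : n.+1 - 2 < n /\ odd (n.+1 - 2) = false by lia.
  by rewrite !bit_cons // bit_twist // o_n addbF.
apply/forallP => i; have lt_i := ltn_ord i.
have [lt1 lt0] : 2 * i + 1 < n /\ 2 * i < n by lia.
have [o1 o0] : odd (2 * i + 1) /\ odd (2 * i) = false by lia.
by rewrite pair_relatedE !bit_cons // !bit_twist // o1 o0 addbF addn1 !eqxx.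
Qed.

(** The only property of the crossed cube that the inductions below rely on, together
    with [twistK].  It also holds for n = 0, where there is a single empty string. *)
Lemma CQ_adj_cons n b c (u v : bits n) :
  CQ_adj [tuple of b :: u] [tuple of c :: v] =
    if b == c then CQ_adj u v else v == twist u.
Proof.
case: n u v => [|n] u v.
  by rewrite /= (tuple0 u) (tuple0 v) (tuple0 (twist _)); case: b; case: c.
have tailK (d : bool) (w : bits n.+1) : btail [tuple of d :: w] = w.
  exact: val_inj.
by rewrite /CQ_adj -/CQ_adj !theadE !tailK crossedE.
Qed.

Arguments CQ_adj n : simpl never.

Lemma CQ_sym n : symmetric (@CQ_adj n).
Proof.
elim: n => [|n IH] // /tupleP[b u] /tupleP[c v].
rewrite !CQ_adj_cons IH eq_sym; case: eqP => // _.
by rewrite -(inj_eq (inv_inj (@twistK n))) twistK eq_sym.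
Qed.

Lemma CQ_irr n : irreflexive (@CQ_adj n).
Proof. by elim: n => [|n IH] // /tupleP[b u]; rewrite CQ_adj_cons eqxx. Qed.

(** Two of three vertices lie in the same copy; if the third lies in the other copy, it
    is matched with only one of them. *)
Lemma CQ_triangle_free n (u v w : bits n) :
  CQ_adj u v -> CQ_adj u w -> CQ_adj v w -> False.
Proof.
elim: n u v w => [|n IH] //.
move=> /tupleP[b u] /tupleP[c v] /tupleP[d w].
rewrite !CQ_adj_cons.
case: b c d => [] [] [] //=; try exact: IH.
all: by [move=> + /eqP-> /eqP/(inv_inj (@twistK n)) eq_uv; rewrite eq_uv CQ_irr
        |move=> /eqP-> + /eqP E; rewrite E twistK CQ_irr
        |move=> /eqP-> /eqP->; rewrite CQ_irr].
Qed.

Lemma big_bits n (F : bits n.+1 -> nat) :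
  \sum_u F u = \sum_(u : bits n) F [tuple of false :: u]
             + \sum_(u : bits n) F [tuple of true :: u].
Proof.
rewrite (reindex (fun p : bool * bits n => [tuple of p.1 :: p.2])) /=.
  rewrite -(pair_bigA _ (fun (b : bool) (u : bits n) => F [tuple of b :: u])) /=.
  by rewrite big_bool addnC.
exists (fun u => (thead u, btail u)) => [[b u] _ | u _] /=.
  by rewrite theadE; congr pair; apply: val_inj.
by rewrite [RHS]tuple_eta; apply: val_inj.
Qed.

Lemma CQ_regular n (u : bits n) : #|[pred v | CQ_adj u v]| = n.
Proof.
rewrite -sum1_card big_mkcond /=.
elim: n u => [|n IH] u; first by rewrite big1.
case/tupleP: u => b u; rewrite big_bits.
have twist1 : \sum_(v : bits n) (if v == twist u then 1 else 0) = 1.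
  by rewrite -big_mkcond big_pred1_eq.
transitivity (\sum_(v : bits n) (if CQ_adj u v then 1 else 0) + 
              \sum_(v : bits n) (if v == twist u then 1 else 0)); last first.
  by rewrite IH twist1 addn1.
by case: b; [rewrite addnC|]; congr addn; apply: eq_bigr => v _;
  rewrite inE CQ_adj_cons.
Qed.

(** * Edge boundaries in the crossed cube *)

Definition boundary n (X : {set bits n}) : nat :=
  \sum_u \sum_v ((u \in X) && (v \notin X) && CQ_adj u v).

Definition half n (b : bool) (X : {set bits n.+1}) : {set bits n} :=
  [set u : bits n | [tuple of b :: u] \in X].

Lemma card_halves n (X : {set bits n.+1}) :
  #|X| = #|half false X| + #|half true X|.
Proof.
rewrite -!sum1_card big_mkcond big_bits /= !(big_mkcond (fun u => u \in _)) /=.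
by congr addn; apply: eq_bigr => u _; rewrite inE.
Qed.

(** The sum counts the edges of the matching that leave X in one copy and miss Y in
    the other; every element of X is matched to one element, so at most #|Y| of the edges
    at X end in Y. *)
Lemma leq_card_sub_twist n (X Y : {set bits n}) :
  #|X| - #|Y| <= \sum_u ((u \in X) && (twist u \notin Y)).
Proof.
rewrite -(card_imset (mem Y) (inv_inj (@twistK n))).
rewrite -big_mkcond sum1_card leq_subLR -[X in X <= _](cardsID (@twist n @: Y)).
apply: leq_add; first exact/subset_leq_card/subsetIr.
apply/subset_leq_card/subsetP => u; rewrite !inE => /andP[YN Xu].
rewrite unfold_in Xu /=.
by apply: contra YN => Yu; apply/imsetP; exists (twist u); rewrite ?twistK.
Qed.

Lemma boundary_halves n (X : {set bits n.+1}) :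
  boundary (half false X) + boundary (half true X)
    + ((#|half false X| - #|half true X|) + (#|half true X| - #|half false X|))
  <= boundary X.
Proof.
have cross b c (u : bits n) : b != c ->
    \sum_(v : bits n) (([tuple of b :: u] \in X) && ([tuple of c :: v] \notin X) &&
       CQ_adj [tuple of b :: u] [tuple of c :: v]) =
    (u \in half b X) && (twist u \notin half c X).
  move=> bc; rewrite (bigD1 (twist u)) //= CQ_adj_cons (negPf bc) eqxx andbT !inE.
  rewrite big1 ?addn0 // => v ne_v.
  by rewrite CQ_adj_cons (negPf bc) (negPf ne_v) andbF.
have same b (u : bits n) :
    \sum_(v : bits n) (([tuple of b :: u] \in X) && ([tuple of b :: v] \notin X) &&
       CQ_adj [tuple of b :: u] [tuple of b :: v]) =
    \sum_v ((u \in half b X) && (v \notin half b X) && CQ_adj u v).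
  by apply: eq_bigr => v _; rewrite CQ_adj_cons eqxx !inE.
rewrite [boundary X]/boundary big_bits.
under eq_bigr => u _ do rewrite big_bits same cross //.
under [X in _ <= _ + X]eq_bigr => u _ do rewrite big_bits same cross //.
rewrite !big_split /= -!/(boundary _).
rewrite [X in _ <= _ + X]addnC [X in _ <= X]addnACA leq_add2l.
by apply: leq_add; apply: leq_card_sub_twist.
Qed.

(** Turns a lower bound on boundaries in CQ_n that depends only on the cardinality into
    one in CQ_(n+1), by splitting a set between the two copies. *)
Lemma boundary_step n (f : nat -> nat) :
  (forall X : {set bits n}, f #|X| <= boundary X) ->
  forall X : {set bits n.+1}, exists a b,
    [/\ #|X| = a + b, a <= 2 ^ n, b <= 2 ^ n
      & f a + f b + ((a - b) + (b - a)) <= boundary X].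
Proof.
move=> f_le X; exists #|half false X|, #|half true X|.
have le2 b : #|half b X| <= 2 ^ n.
  by rewrite -[X in X ^ n]card_bool -card_tuple max_card.
split; rewrite ?le2 -?card_halves //.
apply: leq_trans (boundary_halves X).
by rewrite leq_add2r leq_add.
Qed.

(** Entry s of the list is the minimum, over the ways of splitting s between two
    copies, of the bound given by [boundary_step]; the lists for CQ_0, CQ_1, CQ_2 appear
    in the proof. *)
Lemma boundary3 (X : {set bits 3}) :
  nth 0 [:: 0; 3; 4; 5; 4; 5; 4; 3; 0] #|X| <= boundary X.
Proof.
have step (s t : seq nat) m :
    all (fun a => all (fun b => nth 0 t (a + b) <=
        nth 0 s a + nth 0 s b + ((a - b) + (b - a))) (iota 0 (2 ^ m).+1))
      (iota 0 (2 ^ m).+1) ->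
    (forall Y : {set bits m}, nth 0 s #|Y| <= boundary Y) ->
    forall Y : {set bits m.+1}, nth 0 t #|Y| <= boundary Y.
  move=> ok bound_s Y; have [a [b [-> le_a le_b]]] := boundary_step bound_s Y.
  apply: leq_trans; move/allP: ok => /(_ a); rewrite mem_iota => /(_ le_a).
  by move/allP=> /(_ b); rewrite mem_iota; apply.
apply: (step [:: 0; 2; 2; 2; 0]) X => //.
apply: (step [:: 0; 1; 0]) => //.
apply: (step [:: 0; 0]) => // Y.
by case: #|Y| => [|[|?]] /=; rewrite ?nth_nil.
Qed.

(** The three cases have to be proved together, since a set of CQ_(n+1) can meet a copy
    in any number of vertices.  They say that the boundary is at least that of a vertex,
    of an edge and of a path of three vertices.  The last one fails in CQ_3, where a
    4-cycle has boundary 4 < 5, so the induction starts at CQ_4. *)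
Lemma boundary_ge n (X : {set bits n}) : 3 < n ->
  [/\ 0 < #|X| < 2 ^ n -> n <= boundary X,
      1 < #|X| < 2 ^ n - 1 -> 2 * n - 2 <= boundary X
    & 2 < #|X| < 2 ^ n - 2 -> 3 * n - 4 <= boundary X].
Proof.
elim: n X => // n IH X; rewrite ltnS leq_eqVlt => /predU1P[n3|n_gt3].
  subst n; have [a [b [-> le_a le_b]]] := boundary_step boundary3 X.
  pose phi := nth 0 [:: 0; 3; 4; 5; 4; 5; 4; 3; 0].
  have ok : all (fun a => all (fun b => let S := phi a + phi b + ((a - b) + (b - a)) in
      [&& (0 < a + b < 16) ==> (4 <= S), (1 < a + b < 15) ==> (6 <= S)
        & (2 < a + b < 14) ==> (8 <= S)]) (iota 0 9)) (iota 0 9) by [].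
  have a_in : a \in iota 0 9 by rewrite mem_iota.
  have b_in : b \in iota 0 9 by rewrite mem_iota.
  have /and3P[/implyP h1 /implyP h2 /implyP h3] := allP (allP ok a a_in) b b_in.
  by move=> le_S; split=> [/h1|/h2|/h3] /leq_trans; apply.
(* The induction hypothesis as a bound that depends on the cardinality only. *)
pose f s := if (0 < s < 2 ^ n) then if (1 < s < 2 ^ n - 1) then
  if 2 < s < 2 ^ n - 2 then 3 * n - 4 else 2 * n - 2 else n else 0.
have f_le (Y : {set bits n}) : f #|Y| <= boundary Y.
  by have [h1 h2 h3] := IH Y n_gt3; rewrite /f; do 3?case: ifP => //; auto.
have [a [b [-> le_a le_b]]] := boundary_step f_le X.
have : 4 * n <= 2 ^ n.
  elim: (n) n_gt3 => // k IHk; rewrite leq_eqVlt => /predU1P[<-//|k_gt3].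
  by rewrite expnS; have := IHk k_gt3; lia.
rewrite expnS /f; move: (2 ^ n) le_a le_b => N le_a le_b N_ge le_bd.
by split; move: le_bd; do 6?case: ifP; lia.
Qed.

(** * The BCDC network as a line graph *)

(** The order in which the construction of the BCDC network lists the two ends of an
    edge. *)
Fixpoint lexlt n : rel (bits n) :=
  match n return rel (bits n) with
  | 0 => fun _ _ => false
  | m.+1 => fun u v =>
      if thead u == thead v then lexlt (btail u) (btail v) else thead v
  end.

Lemma btail_cons n (b : bool) (u : bits n) : btail [tuple of b :: u] = u.
Proof. exact: val_inj. Qed.

Lemma lexlt_cons n (b c : bool) (u v : bits n) :
  lexlt [tuple of b :: u] [tuple of c :: v] = if b == c then lexlt u v else c.
Proof. by rewrite /= !theadE !btail_cons. Qed.

Arguments lexlt n : simpl never.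

Lemma lexlt_total n (u v : bits n) : u != v -> lexlt u v || lexlt v u.
Proof.
elim: n u v => [|n IH] u v; first by rewrite (tuple0 u) (tuple0 v).
case/tupleP: u => b u; case/tupleP: v => c v; rewrite !lexlt_cons => ne_uv.
have [eq_bc|] := eqVneq b c; last by case: b c {ne_uv} => [] [].
by apply: IH; apply: contraNneq ne_uv => ->; rewrite eq_bc.
Qed.

Lemma lexlt_asym n (u v : bits n) : lexlt u v -> lexlt v u = false.
Proof.
elim: n u v => [|n IH] // /tupleP[b u] /tupleP[c v]; rewrite !lexlt_cons.
by case: b c => [] [] //; apply: IH.
Qed.

Lemma cons_tuple_eq n (b c : bool) (u v : bits n) :
  ([tuple of b :: u] == [tuple of c :: v]) = (b == c) && (u == v).
Proof. by []. Qed.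

Lemma BCDC_vertexE n (p : bits_pair n) : 1 < n ->
  BCDC_vertex p = lexlt p.1 p.2 && CQ_adj p.1 p.2.
Proof.
elim: n p => [|[|[|n]] IH] // [].
  case/tupleP=> b1 /tupleP[b0 u] /tupleP[c1 /tupleP[c0 v]] _.
  have twist1 (w : bits 1) : twist w = w.
    by apply: eq_bits => -[|//] _; rewrite bit_twist // addbF.
  rewrite !(lexlt_cons, CQ_adj_cons) twist1 cons_tuple_eq.
  rewrite (tuple0 u) (tuple0 v) (tuple0 (twist _)).
  by case: b1 b0 c1 c0 => [] [] [] [].
case/tupleP=> b u /tupleP[c v] _.
have -> : BCDC_vertex ([tuple of b :: u], [tuple of c :: v]) =
  [|| (b == false) && (c == false) && BCDC_vertex (u, v),
      (b == true) && (c == true) && BCDC_vertex (u, v)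
    | [&& b == false, c == true
        & CQ_adj [tuple of b :: u] [tuple of c :: v]]].
  by rewrite /BCDC_vertex -/BCDC_vertex /in_copy /in_S /ptail !theadE !btail_cons.
rewrite IH // lexlt_cons CQ_adj_cons.
by case: b c => [] [] /=; rewrite ?orbF ?andbF.
Qed.

Arguments BCDC_vertex n : simpl never.
Arguments BCDC_rel n : simpl never.

(** Vertices of the independent set S_n never share an entry, since their entries are
    matched; vertices in different copies do not either, by their leading bits. *)
Lemma BCDC_relE n (p q : bits_pair n) : 1 < n -> BCDC_vertex p -> BCDC_vertex q ->
  BCDC_rel p q = (p != q) && share_entry p q.
Proof.
elim: n p q => [|[|[|n]] IH] // p q _; rewrite !BCDC_vertexE // BCDC_relS.
case: p q => [p1 p2] [q1 q2] /=.
case/tupleP: p1 p2 => b u /tupleP[b' u'].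
case/tupleP: q1 q2 => c v /tupleP[c' v'].
rewrite /link /share_entry /in_copy /in_S /ptail /= !theadE !btail_cons.
rewrite !lexlt_cons !CQ_adj_cons xpair_eqE !cons_tuple_eq.
case: b b' => [] [] //=; case: c c' => [] [] //=; 
  rewrite ?andbF ?andbT ?orbF ?eqxx //= => hp hq.
- by rewrite IH ?BCDC_vertexE // xpair_eqE.
- by rewrite hq.
- by rewrite hp eq_sym [v' == _]eq_sym.
- rewrite (eqP hp) (eqP hq) (inj_eq (inv_inj (@twistK _))).
  by case: (u == v).
- by rewrite hp eq_sym [v' == _]eq_sym.
- by rewrite hq.
- by rewrite IH ?BCDC_vertexE // xpair_eqE.
Qed.

Section LineGraph.

Variables (n : nat) (n_gt1 : 1 < n).
Implicit Types (u v w : bits n) (x y : BCDC n).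

Definition inc u x := (u == (val x).1) || (u == (val x).2).

Lemma edge_ends x : exists u v,
  CQ_adj u v /\ forall w, inc w x = (w == u) || (w == v).
Proof.
exists (val x).1, (val x).2; split=> //.
by have := valP x; rewrite BCDC_vertexE // => /andP[].
Qed.

Lemma edge_exists u v : CQ_adj u v ->
  exists x : BCDC n, forall w, inc w x = (w == u) || (w == v).
Proof.
move=> uv; have ne_uv : u != v by apply: contraTneq uv => ->; rewrite CQ_irr.
have vtx (p : bits_pair n) : lexlt p.1 p.2 && CQ_adj p.1 p.2 -> BCDC_vertex p.
  by rewrite BCDC_vertexE.
case/orP: (lexlt_total ne_uv) => lt_uv.
  have uvP : BCDC_vertex (u, v) by rewrite vtx // lt_uv uv.
  by exists (exist _ (u, v) uvP).
have vuP : BCDC_vertex (v, u) by rewrite vtx // lt_uv CQ_sym uv.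
by exists (exist _ (v, u) vuP) => w; rewrite /inc /= orbC.
Qed.

Lemma inc_adj u v x : u != v -> inc u x -> inc v x -> CQ_adj u v.
Proof.
move=> ne_uv; have [a [b [ab ends]]] := edge_ends x; rewrite !ends.
case/orP=> /eqP eq_u /orP[] /eqP eq_v; subst u v; rewrite ?eqxx // in ne_uv *.
by rewrite CQ_sym.
Qed.

Lemma inc_inj u v x y : u != v ->
  inc u x -> inc v x -> inc u y -> inc v y -> x = y.
Proof.
have lt x' : lexlt (val x').1 (val x').2.
  by have := valP x'; rewrite BCDC_vertexE // => /andP[].
move=> ne_uv ux vx uy vy; apply: val_inj.
move: ux vx uy vy (lt x) (lt y); rewrite /inc.
case: (val x) (val y) => [a b] [c d] /=.
do 4![case/orP=> /eqP ?]; subst; rewrite ?eqxx // in ne_uv *.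
  by move/lexlt_asym->.
by move/lexlt_asym->.
Qed.

Lemma inc_other u x : inc u x ->
  exists v, CQ_adj u v /\ forall w, inc w x = (w == u) || (w == v).
Proof.
have [a [b [ab ends]]] := edge_ends x; rewrite ends.
case/orP=> /eqP->; first by exists b.
by exists a; rewrite CQ_sym; split=> // w; rewrite ends orbC.
Qed.

Lemma inc_two a b w (x : BCDC n) :
  a != b -> inc a x -> inc b x -> inc w x -> (w == a) || (w == b).
Proof.
move=> ne_ab ax bx wx; have [c [_ ends]] := inc_other ax.
by move: bx wx; rewrite !ends eq_sym (negPf ne_ab) => /eqP->.
Qed.

Lemma edge_neq w a b (x y : BCDC n) : inc w x -> inc w y -> inc a x -> inc b y ->
  a != w -> b != w -> a != b -> x != y.
Proof.
move=> wx wy ax by_ aw bw; apply: contraNneq => eq_xy; subst y.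
by have := inc_two aw ax wx by_; rewrite (negPf bw) orbF eq_sym.
Qed.

Lemma BCDC_adjE x y :
  adj x y = (x != y) && [exists u, inc u x && inc u y].
Proof.
rewrite [adj x y]BCDC_relE ?(valP x) ?(valP y) // -val_eqE; congr andb.
rewrite /share_entry; apply/idP/existsP => [|[u]]; rewrite /inc.
  by case/or4P=> /eqP E; [exists (val x).1|exists (val x).1|exists (val x).2
    |exists (val x).2]; rewrite E !eqxx ?orbT.
by case/andP=> /orP[] /eqP-> /orP[] ->; rewrite ?orbT.
Qed.

Lemma inc_clique u x y : inc u x -> inc u y -> x != y -> adj x y.
Proof.
by move=> ux uy ne; rewrite BCDC_adjE ne; apply/existsP; exists u; rewrite ux.
Qed.

Definition star u : {set BCDC n} := [set x | inc u x].

Lemma card_star u : #|star u| = n.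
Proof.
pose other x := if u == (val x).1 then (val x).2 else (val x).1.
have otherP x : inc u x ->
    CQ_adj u (other x) /\ forall w, inc w x = (w == u) || (w == other x).
  rewrite /other /inc; have := valP x; rewrite BCDC_vertexE // => /andP[_ adj_x].
  have [->|_ /eqP->] := eqVneq u (val x).1; first by split.
  by split=> [|w]; rewrite 1?CQ_sym // orbC.
rewrite -[RHS](CQ_regular u) -(card_in_imset (f := other)); last first.
  move=> x y; rewrite !inE => ux uy eq_xy.
  have [adj_x ends_x] := otherP x ux; have [adj_y ends_y] := otherP y uy.
  apply: (@inc_inj u (other x)) => //; rewrite ?ends_x ?ends_y ?eq_xy ?eqxx ?orbT //.
  by rewrite -eq_xy; apply: contraTneq adj_x => <-; rewrite CQ_irr.
apply/eq_card => v; rewrite inE; apply/imsetP/idP => [[x]|uv].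
  by rewrite inE => /otherP[ux _] ->.
have [x ends] := edge_exists uv; exists x; first by rewrite inE ends eqxx.
have ux : inc u x by rewrite ends eqxx.
have [adj_x ends_x] := otherP x ux.
have := ends v; rewrite ends_x eqxx orbT => /predU1P[eq_vu|/eqP//].
by rewrite eq_vu CQ_irr in uv.
Qed.

End LineGraph.

(** * Vertex cuts of the BCDC network as edge cuts of the crossed cube *)

Section EdgeCuts.

Variables (n : nat) (n_gt1 : 1 < n) (U : {set BCDC n}).

(** The unions of components of the crossed cube without the edges of U. *)
Definition undeleted_closed (X : {set bits n}) :=
  forall x u v, x \notin U -> inc u x -> inc v x -> u \in X -> v \in X.

Lemma undeleted_closedC X : undeleted_closed X -> undeleted_closed (~: X).
Proof.
by move=> freeX x u v xU ux vx; rewrite !inE; apply: contra; apply: freeX ux.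
Qed.

Lemma boundary_leq_card X : undeleted_closed X -> boundary X <= #|U|.
Proof.
move=> freeX; rewrite /boundary pair_bigA /= -big_mkcond sum1_card.
(* Lists first the end that lies in X. *)
pose orient (x : BCDC n) := if (val x).1 \in X then val x else ((val x).2, (val x).1).
apply: leq_trans (leq_imset_card orient U).
apply/subset_leq_card/subsetP => -[u v]; rewrite unfold_in /=.
case/andP=> /andP[Xu XvN] uv.
have [x ends] := edge_exists n_gt1 uv.
have xU : x \in U.
  apply: contraR XvN => xU.
  by apply: (freeX x u) => //; rewrite ends eqxx ?orbT.
apply/imsetP; exists x => //.
have := valP x; rewrite BCDC_vertexE // => /andP[_].
have : inc (val x).1 x && inc (val x).2 x by rewrite /inc !eqxx orbT.
rewrite /orient !ends; case: (val x) => a b /=.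
case/andP=> /orP[] /eqP-> /orP[] /eqP->; rewrite ?CQ_irr // ?Xu //.
by rewrite (negPf XvN).
Qed.

(** If X consists of the ends of x, then x alone spans a component of what is left. *)
Lemma small_undeleted_closed X x : undeleted_closed X -> #|X| <= 2 -> x \notin U ->
  (val x).1 \in X -> (val x).2 \in X -> forall y, adj x y -> y \in U.
Proof.
move=> freeX card_X xU X1 X2 y; apply: contraLR => yU.
have adj_x : CQ_adj (val x).1 (val x).2.
  by have := valP x; rewrite BCDC_vertexE // => /andP[].
have ne12 : (val x).1 != (val x).2.
  by apply: contraTneq adj_x => ->; rewrite CQ_irr.
have X_ends : X = [set (val x).1; (val x).2].
  apply/esym/eqP; rewrite eqEcard cards2 ne12 card_X andbT.
  by apply/subsetP => w; rewrite !inE => /orP[] /eqP->.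
rewrite BCDC_adjE // negb_and negb_exists negbK.
have [//|ne_xy /=] := eqVneq x y; apply/forallP => w; apply/negP => /andP[wx wy].
have Xw : w \in X by rewrite X_ends !inE.
have [w' [ww' ends]] := inc_other n_gt1 wy.
have Xw' : w' \in X by apply: (freeX y w) => //; rewrite ends eqxx orbT.
case/eqP: ne_xy; apply: (@inc_inj _ n_gt1 w w') => //.
- by apply: contraTneq ww' => <-; rewrite CQ_irr.
- by move: Xw'; rewrite X_ends !inE.
- by rewrite ends eqxx orbT.
Qed.

(** With X the component of the ends of a remaining edge, either X or its complement is
    the pair of ends of a remaining edge, or [boundary_ge] applies to X. *)
Lemma cut_isolates_or_large : 3 < n ->
  disconnected (del_vertices U) \/ trivial_graph (del_vertices U) ->
  (exists2 x, x \notin U & forall y, adj x y -> y \in U) \/ 3 * n - 4 <= #|U|.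
Proof.
move=> n_gt3; case; last first.
  move/eqP/fintype1P => [x all_x]; left; exists (val x); first exact: valP x.
  move=> y; apply: contraLR => yU.
  by rewrite -[y]/(val (Sub y yU : del_vertices U)) (all_x (Sub y yU)) adj_irr.
move=> [x [y xy_sep]].
pose free u v := [exists z : BCDC n, [&& z \notin U, inc u z & inc v z]].
pose X := [set w | connect free (val (val x)).1 w].
have freeX : undeleted_closed X.
  move=> z u v zU uz vz; rewrite !inE => /connect_trans; apply.
  by apply/connect1/existsP; exists z; rewrite zU uz.
have link (s t : del_vertices U) w :
    inc w (val s) -> inc w (val t) -> connect (@adj (del_vertices U)) s t.
  move=> ws wt; have [->|ne_st] := eqVneq s t; first exact: connect0.
  apply: connect1; rewrite [adj s t]/(adj (val s) (val t)).
  by apply: (inc_clique n_gt1 ws wt); apply: contraNneq ne_st => /val_inj->.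
have reach w (z : del_vertices U) :
    w \in X -> inc w (val z) -> connect (@adj (del_vertices U)) x z.
  rewrite inE => /connectP[p + ->]; move: z.
  have : forall z : del_vertices U, inc (val (val x)).1 (val z) ->
      connect (@adj (del_vertices U)) x z.
    by move=> z; apply: link; rewrite /inc eqxx.
  elim: p (val (val x)).1 => [|v p IH] u /= reach_u z.
    by move=> _; apply: reach_u.
  case/andP=> /existsP[t /and3P[tU ut vt]]; apply: IH => {}z vz.
  pose t' : del_vertices U := exist _ t tU.
  exact: connect_trans (reach_u t' ut) (link t' z v vt vz).
have X1 : (val (val x)).1 \in X by rewrite inE connect0.
have X2 : (val (val x)).2 \in X.
  by apply: (freeX (val x)) X1; rewrite ?(valP x) // /inc eqxx ?orbT.
have Y1 : (val (val y)).1 \in ~: X.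
  by rewrite inE; apply: contra xy_sep => /reach; apply; rewrite /inc eqxx.
have Y2 : (val (val y)).2 \in ~: X.
  by rewrite inE; apply: contra xy_sep => /reach; apply; rewrite /inc eqxx orbT.
have cardX : #|X| + #|~: X| = 2 ^ n by rewrite cardsC card_tuple card_bool.
have [X_small|X_big] := leqP #|X| 2.
  left; exists (val x); first exact: valP x.
  exact: (small_undeleted_closed freeX X_small (valP x) X1 X2).
have [Y_small|Y_big] := leqP #|~: X| 2.
  left; exists (val y); first exact: valP y.
  exact: (small_undeleted_closed (undeleted_closedC freeX) Y_small (valP y) Y1 Y2).
right; apply: leq_trans (boundary_leq_card freeX).
have [_ _] := boundary_ge X n_gt3; apply.
by rewrite X_big -cardX ltn_subRL addnC ltn_add2l.
Qed.

End EdgeCuts.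

(** * Covers by cycles in an arbitrary graph *)

Lemma leq_card_bigcup (I T : finType) (P : {set I}) (F : I -> {set T}) c :
  (forall i, i \in P -> #|F i| <= c) -> #|\bigcup_(i in P) F i| <= c * #|P|.
Proof.
move=> F_le; apply: (@leq_trans (\sum_(i in P) c)); last first.
  by rewrite sum_nat_const mulnC.
apply: (@leq_trans (\sum_(i in P) #|F i|)); last exact: leq_sum.
elim/big_rec2: _ => [|i s X _ le_X]; first by rewrite cards0.
by apply: leq_trans (leq_card_setU _ _) _; rewrite leq_add2l.
Qed.

Lemma subset_between (T : finType) (X Y : {set T}) m :
  X \subset Y -> #|X| <= m <= #|Y| ->
  exists Z : {set T}, [/\ X \subset Z, Z \subset Y & #|Z| = m].
Proof.
move=> sXY /andP[le_Xm le_mY].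
have -> : m = #|X| + (m - #|X|) by rewrite subnKC.
have : #|X| + (m - #|X|) <= #|Y| by rewrite subnKC.
elim: (m - #|X|) => [|d IH] le_d; first by exists X; rewrite addn0.
have [|Z [sXZ sZY cardZ]] := IH; first by apply: leq_trans le_d; rewrite leq_add2l.
have /card_gt0P[y] : 0 < #|Y :\: Z|.
  have := cardsID Z Y; rewrite (setIidPr sZY); lia.
rewrite inE => /andP[yNZ yY]; exists (y |: Z); split.
- exact: subset_trans sXZ (subsetUr _ _).
- by rewrite subUset sub1set yY.
- by rewrite cardsU1 yNZ; lia.
Qed.

Section Cycles.

Variable G : sgraph.
Implicit Types (C K T : {set G}) (s p : seq G).

Definition clique K := forall y z, y \in K -> z \in K -> y != z -> adj y z.

Definition kcycle k C :=
  exists s, [/\ uniq s, cycle (@adj G) s, size s = k & C = [set x in s]].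

Lemma cycle_nth s x0 i : uniq s -> cycle (@adj G) s -> i < size s ->
  adj (nth x0 s i) (nth x0 s (i.+1 %% size s)).
Proof.
move=> s_uniq s_cycle lt_i.
have := next_cycle s_cycle (mem_nth x0 lt_i); rewrite next_nth mem_nth //.
case: s s_uniq {s_cycle} lt_i => [|x s] // s_uniq lt_i.
rewrite index_uniq //; move: lt_i; rewrite ltnS leq_eqVlt => /predU1P[i_last|lt_i].
  by rewrite [nth x s i]nth_default i_last ?modnn.
by rewrite modn_small // (set_nth_default x0 x lt_i).
Qed.

Lemma kcycle_subgraph k C : kcycle k C ->
  exists S : subgraph G, [/\ is_subgraph S, subgraph_iso (cycle_graph k) S & S.1 = C].
Proof.
case=> s [s_uniq s_cycle size_s ->]; subst k.
pose f (i : 'I_(size s)) := tnth (in_tuple s) i.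
have f_inj : injective f by apply/tuple_uniqP.
have nextP i : adj (f i) (f (ordS i)).
  by rewrite /f !(tnth_nth (f i)) /=; apply: cycle_nth.
have adj_f i j : cycle_adj i j -> adj (f i) (f j).
  by case/andP=> _ /orP[] /eqP <-; rewrite 1?[adj _ (f j)]adj_sym; apply: nextP.
exists ([set f i | i in 'I_(size s)],
        [set [set f i; f j] | i in 'I_(size s), j in 'I_(size s) & cycle_adj i j]).
split => /=.
- move=> _ /imset2P[i j _ ij ->]; rewrite inE in ij; split.
    by apply/imset2P; exists (f i) (f j); rewrite ?inE ?adj_f.
  by apply/subsetP => x; rewrite !inE => /orP[] /eqP->; apply: imset_f.
- exists f; split=> // i j; apply/idP/imset2P => [ij|[i' j' _]].
    by exists i j; rewrite ?inE.
  rewrite inE => ij' eq_ij.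
  have ne_ij' : i' != j' by case/andP: ij'.
  have : (f i' \in [set f i; f j]) && (f j' \in [set f i; f j]).
    by rewrite eq_ij !inE !eqxx orbT.
  rewrite !inE !(inj_eq f_inj) => /andP[/orP[] /eqP E1 /orP[] /eqP E2]; subst;
    rewrite ?eqxx // in ne_ij' *.
  by rewrite [adj _ _]cycle_adj_sym.
- apply/setP => x; rewrite inE.
  apply/imsetP/idP => [[i _ ->]|/(tnthP (in_tuple s))[i ->]]; first exact: mem_tnth.
  by exists i.
Qed.

Lemma clique_path K x p : clique K -> uniq (x :: p) -> {subset x :: p <= K} ->
  path (@adj G) x p.
Proof.
move=> K_clique; elim: p x => [|y p IH] x //= /and3P[].
rewrite inE negb_or => /andP[ne_xy xNp] yNp p_uniq sub.
rewrite K_clique ?sub ?inE ?eqxx ?orbT //=; apply: IH; first by rewrite /= yNp.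
by move=> z zp; rewrite sub // inE zp orbT.
Qed.

Lemma kcycle_clique k C : 1 < k -> clique C -> #|C| = k -> kcycle k C.
Proof.
move=> k_gt1 C_clique card_C; exists (enum C).
split; rewrite ?enum_uniq -?cardE //; last first.
  by apply/setP => x; rewrite inE mem_enum.
have := enum_uniq C; have : {subset enum C <= C} by move=> x; rewrite mem_enum.
have : 1 < size (enum C) by rewrite -cardE card_C.
case: (enum C) => [|x [|y s]] // _ sub s_uniq.
rewrite /cycle rcons_path (clique_path C_clique s_uniq sub) /=.
apply: C_clique; last 1 first.
- by move: s_uniq => /= /andP[xN _]; apply: contraNneq xN => <-; apply: mem_last.
- by apply: sub; rewrite inE mem_last orbT.
- by apply: sub; rewrite mem_head.
Qed.

Lemma clique_hamiltonian_path T x y : clique T -> x \in T -> y \in T -> x != y ->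
  exists p, [/\ uniq (x :: p), path (@adj G) x p, last x p = y & x :: p =i T].
Proof.
move=> T_clique xT yT ne_xy; exists (rcons (enum (T :\ x :\ y)) y).
have mem_p : x :: rcons (enum (T :\ x :\ y)) y =i T.
  move=> z; rewrite inE mem_rcons inE mem_enum !inE.
  have [->|_] := eqVneq z x; first by rewrite xT.
  by have [->|] := eqVneq z y; rewrite ?yT.
have p_uniq : uniq (x :: rcons (enum (T :\ x :\ y)) y).
  rewrite /= mem_rcons rcons_uniq inE !mem_enum !inE !eqxx enum_uniq.
  by rewrite (negPf ne_xy) andbF.
split; rewrite ?last_rcons //; apply: clique_path T_clique p_uniq _.
by move=> z; rewrite mem_p.
Qed.

(** Hamiltonian paths of the two cliques, from x1 to y1 and from x2 to y2, are joined
    through the sequences s1 and s2, which may be empty. *)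
Lemma kcycle_bridge T1 T2 x1 y1 x2 y2 s1 s2 :
    clique T1 -> x1 \in T1 -> y1 \in T1 -> x1 != y1 ->
    clique T2 -> x2 \in T2 -> y2 \in T2 -> x2 != y2 ->
    [disjoint T1 & T2] -> uniq (s1 ++ s2) ->
    (forall z, z \in s1 ++ s2 -> z \notin T1 :|: T2) ->
    path (@adj G) y1 (rcons s1 x2) -> path (@adj G) y2 (rcons s2 x1) ->
  kcycle (#|T1| + #|T2| + size s1 + size s2) (T1 :|: T2 :|: [set z in s1 ++ s2]).
Proof.
move=> cl1 x1T y1T ne1 cl2 x2T y2T ne2 disj s_uniq sN.
have [p1 [u1 path1 last1 mem1]] := clique_hamiltonian_path cl1 x1T y1T ne1.
have [p2 [u2 path2 last2 mem2]] := clique_hamiltonian_path cl2 x2T y2T ne2.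
rewrite !rcons_path => /andP[path_s1 last_s1] /andP[path_s2 last_s2].
exists ((x1 :: p1) ++ s1 ++ (x2 :: p2) ++ s2).
have perm : perm_eq ((x1 :: p1) ++ s1 ++ (x2 :: p2) ++ s2)
                    (((x1 :: p1) ++ (x2 :: p2)) ++ s1 ++ s2).
  by rewrite -!catA perm_cat2l perm_catCA.
have card_p T x p : uniq (x :: p) -> x :: p =i T -> #|T| = size (x :: p).
  by move=> /card_uniqP <- eqT; apply: eq_card => z; rewrite eqT.
split.
- rewrite (perm_uniq perm) cat_uniq s_uniq andbT cat_uniq u1 u2 andbT andTb.
  apply/andP; split.
    apply/hasPn => z; rewrite mem2 mem1 => zT2.
    by apply/negP => zT1; have := pred0P disj z; rewrite /= zT1 zT2.
  apply/hasPn => z /sN zN; apply: contra zN.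
  by rewrite in_setU -mem1 -mem2 -mem_cat.
- rewrite /= rcons_cat cat_path path1 last1 /= -cat_rcons !rcons_cat !cat_path.
  by rewrite !rcons_path last_rcons path_s1 last_s1 path2 last2 path_s2 last_s2.
- rewrite (perm_size perm) !size_cat (card_p _ _ _ u1 mem1) (card_p _ _ _ u2 mem2).
  by rewrite !addnA.
- by apply/setP => z; rewrite !in_setU 2!in_set (perm_mem perm) !mem_cat mem1 mem2.
Qed.

(** The vertex x is the one that the cycles are meant to isolate, hence must avoid. *)
Definition coverable k x m T := exists F : {set subgraph G},
  [/\ #|F| <= m, forall S, S \in F -> is_subgraph S,
      forall S, S \in F -> subgraph_iso (cycle_graph k) S,
      x \notin cover_vertices F & T \subset cover_vertices F].

Variables (k : nat) (x : G).

Lemma coverable0 : coverable k x 0 set0.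
Proof.
exists set0; rewrite /cover_vertices big_set0 cards0 inE sub0set.
by split=> // S; rewrite inE.
Qed.

Lemma coverable1 C T : kcycle k C -> x \notin C -> T \subset C -> coverable k x 1 T.
Proof.
move=> /kcycle_subgraph[S [S_sub S_iso <-]] xN sTS; exists [set S].
by rewrite /cover_vertices big_set1 cards1; split=> // S'; rewrite inE => /eqP->.
Qed.

Lemma coverableU m1 m2 T1 T2 : coverable k x m1 T1 -> coverable k x m2 T2 ->
  coverable k x (m1 + m2) (T1 :|: T2).
Proof.
move=> [F1 [le1 sub1 iso1 xN1 cov1]] [F2 [le2 sub2 iso2 xN2 cov2]].
have coverU : cover_vertices (F1 :|: F2) = cover_vertices F1 :|: cover_vertices F2.
  exact: bigcup_setU.
exists (F1 :|: F2); rewrite coverU in_setU negb_or xN1 xN2 setUSS //; split=> //.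
- exact: leq_trans (leq_card_setU _ _) (leq_add le1 le2).
- by move=> S; rewrite inE => /orP[]; [apply: sub1|apply: sub2].
- by move=> S; rewrite inE => /orP[]; [apply: iso1|apply: iso2].
Qed.

Lemma coverable_sub m T T' : T \subset T' -> coverable k x m T' -> coverable k x m T.
Proof.
by move=> sTT' [F [? ? ? ? cov]]; exists F; split=> //; apply: subset_trans cov.
Qed.

(** The part of T that one cycle covers may have fewer than k elements, when it is the
    last one; it is then completed inside K. *)
Lemma coverable_clique K m T : 1 < k <= #|K| -> clique K -> x \notin K ->
  T \subset K -> #|T| <= m * k -> coverable k x m T.
Proof.
move=> /andP[k_gt1 le_kK] K_clique xNK; elim: m T => [|m IH] T sTK.
  by rewrite leqn0 cards_eq0 => /eqP->; apply: coverable0.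
rewrite mulSn => card_T.
have le_min : #|(set0 : {set G})| <= minn k #|T| <= #|T| by rewrite cards0 geq_minr.
have [T1 [_ sT1T card_T1]] := subset_between (sub0set T) le_min.
have le_k : #|T1| <= k <= #|K| by rewrite card_T1 geq_minl.
have [C [sT1C sCK card_C]] := subset_between (subset_trans sT1T sTK) le_k.
have -> : T = T1 :|: (T :\: T1) by rewrite setUC -{1}(setID T T1) (setIidPr sT1T) setUC.
rewrite -add1n; apply: coverableU.
  apply: coverable1 sT1C; last by apply: contra xNK; apply: (subsetP sCK).
  by apply: kcycle_clique => // y z yC zC; apply: K_clique; apply: (subsetP sCK).
apply: IH; first exact: subset_trans (subsetDl _ _) sTK.
by rewrite cardsD (setIidPr sT1T) card_T1; lia.
Qed.

End Cycles.

(** * Cycles that avoid a given edge of the crossed cube *)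

Section CyclesAroundAnEdge.

Variables (n : nat) (n_gt1 : 1 < n).

Lemma star_clique w (T : {set BCDC n}) : T \subset star w -> clique T.
Proof.
move=> /subsetP sT y z /sT; rewrite inE => wy /sT; rewrite inE => wz.
exact: inc_clique wy wz.
Qed.

Variables (e : BCDC n) (u v : bits n).
Hypotheses (uv : CQ_adj u v) (ends_e : forall w, inc w e = (w == u) || (w == v)).

Local Notation A := (star u :\ e).
Local Notation B := (star v :\ e).

Fact ne_uv : u != v.
Proof. by apply: contraTneq uv => ->; rewrite CQ_irr. Qed.

Fact ue : inc u e. Proof. by rewrite ends_e eqxx. Qed.
Fact ve : inc v e. Proof. by rewrite ends_e eqxx orbT. Qed.

Lemma card_side w : inc w e -> #|star w :\ e| = n.-1.
Proof.
move=> we; have := cardsD1 e (star w); rewrite card_star // inE we add1n.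
by move/(congr1 predn) => /= ->.
Qed.

Lemma sides_disjoint x : x \in A -> x \in B -> False.
Proof.
rewrite !inE => /andP[/eqP ne_xe ux] /andP[_ vx].
exact: ne_xe (inc_inj n_gt1 ne_uv ux vx ue ve).
Qed.

(** An edge at u and an edge at v, both other than uv, can only meet in a common
    neighbour of u and v. *)
Lemma adj_same_side x y :
  x \in A :|: B -> y \in A :|: B -> adj x y -> (x \in A) = (y \in A).
Proof.
have wlog_side a b : a \in A -> b \in A :|: B -> adj a b -> b \in A.
  move=> aA; rewrite in_setU BCDC_adjE // => /orP[//|bB].
  case/andP=> _ /existsP[w /andP[wa wb]]; exfalso.
  have [ne_ae ua] : a != e /\ inc u a by move: aA; rewrite !inE => /andP[].
  have [ne_be vb] : b != e /\ inc v b by move: bB; rewrite !inE => /andP[].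
  have ne_uw : u != w.
    by apply/eqP => eq_uw; apply: (sides_disjoint _ bB); rewrite !inE ne_be eq_uw.
  have ne_vw : v != w.
    by apply/eqP => eq_vw; apply: (sides_disjoint aA); rewrite !inE ne_ae eq_vw.
  apply: (CQ_triangle_free uv (inc_adj n_gt1 ne_uw ua wa)).
  exact: (inc_adj n_gt1 ne_vw vb wb).
move=> xN yN xy; apply/idP/idP => side; first exact: wlog_side xy.
by apply: wlog_side side xN _; rewrite adj_sym.
Qed.

(** An edge z meeting two edges wa and wb away from w would be ab, and w, a, b would be
    a triangle. *)
Lemma no_detour w (x y z : BCDC n) : inc w x -> inc w y -> x != y -> ~~ inc w z ->
  adj z x -> adj z y -> False.
Proof.
move=> wx wy ne_xy wNz; rewrite !BCDC_adjE //.
move=> /andP[_ /existsP[a /andP[az ax]]] /andP[_ /existsP[b /andP[bz by_]]].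
have ne_wa : w != a by apply: contraNneq wNz => ->.
have ne_wb : w != b by apply: contraNneq wNz => ->.
have ne_ab : a != b.
  apply: contraNneq ne_xy => eq_ab; subst b.
  by apply/eqP/(inc_inj n_gt1 ne_wa).
apply: (@CQ_triangle_free _ w a b).
- exact: (inc_adj n_gt1 _ wx ax).
- exact: (inc_adj n_gt1 _ wy by_).
- exact: (inc_adj n_gt1 _ az bz).
Qed.

(** Going round the cycle without leaving A and B one stays on the same side.  Hence a
    cycle with a single vertex outside A and B would have both neighbours of that vertex
    on the same side, which [no_detour] excludes. *)
Lemma cycle_trace k (S : subgraph (BCDC n)) : 2 < k ->
  is_subgraph S -> subgraph_iso (cycle_graph k) S -> e \notin S.1 ->
  #|S.1| = k /\
  [\/ S.1 \subset A, S.1 \subset B | #|S.1 :&: (A :|: B)| + 2 <= k].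
Proof.
move=> k_gt2 S_sub [f [f_inj S1E f_adj]] eNS.
have k_gt0 : 0 < k by lia.
have adj_f i j : cycle_adj i j -> adj (f i) (f j).
  move=> ij; have /S_sub[] : [set f i; f j] \in S.2 by rewrite -[_ \in _]f_adj.
  case/imset2P=> x y _; rewrite inE => xy eq_xy _.
  have : (f i \in [set x; y]) && (f j \in [set x; y]).
    by rewrite -eq_xy !inE !eqxx orbT.
  have ne_ij : f i != f j by rewrite (inj_eq f_inj); case/andP: ij.
  rewrite !inE => /andP[/orP[] /eqP E1 /orP[] /eqP E2];
    rewrite ?E1 ?E2 ?eqxx // in ne_ij *.
  by rewrite adj_sym.
split; first by rewrite S1E card_imset // card_ord.
(* The vertex reached after t steps along the cycle from i. *)
pose step (i : 'I_k) t : 'I_k := Ordinal (ltn_pmod (i + t) k_gt0).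
have step0 i : step i 0 = i by apply: val_inj; rewrite /= addn0 modn_small.
have adj_step i t : adj (f (step i t)) (f (step i t.+1)).
  apply/adj_f/andP; split.
    apply/eqP => /(congr1 val) /=; rewrite addnS.
    rewrite -[in LHS](addn0 (i + t)) -addn1 => /eqP.
    by rewrite eqn_modDl mod0n modn_small // ltnW.
  apply/orP; left; apply/eqP/val_inj.
  by rewrite /= addnS -(addn1 (_ %% _)) -(addn1 (i + t)) modnDml.
have [all_in|[i0 i0N]] : (forall i, f i \in A :|: B) \/ exists i, f i \notin A :|: B.
- have [/forallP|] := boolP [forall i, f i \in A :|: B]; first by left.
  by rewrite negb_forall => /existsP; right.
- pose i0 := Ordinal k_gt0.
  have sameA t : (f (step i0 t) \in A) = (f i0 \in A).
    elim: t => [|t IH]; first by rewrite step0.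
    by rewrite -IH; apply: adj_same_side; rewrite // adj_sym.
  have all_i i : (f i \in A) = (f i0 \in A).
    rewrite -(sameA i); congr (f _ \in A).
    by apply: val_inj; rewrite /= add0n modn_small.
  case: (boolP (f i0 \in A)) => side; [apply: Or31|apply: Or32];
    apply/subsetP => x; rewrite S1E => /imsetP[i _ ->]; first by rewrite all_i.
  by have := all_in i; rewrite in_setU all_i (negPf side).
- apply: Or33.
  have [/existsP[i1 /andP[ne_i10 i1N]]|] :=
      boolP [exists i, (i != i0) && (f i \notin A :|: B)].
    have cardS : #|S.1| = k by rewrite S1E card_imset // card_ord.
    have card2 : #|[set f i0; f i1]| = 2 by rewrite cards2 (inj_eq f_inj) eq_sym ne_i10.
    have sub2 : [set f i0; f i1] \subset S.1 :\: (A :|: B).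
      apply/subsetP => x; rewrite !in_set2 in_setD S1E.
      by case/orP=> /eqP->; rewrite ?i0N ?i1N imset_f.
    rewrite -[in leqRHS]cardS -(cardsID (A :|: B) S.1) leq_add2l.
    by rewrite -card2 subset_leq_card.
  rewrite negb_exists => /forallP others; exfalso.
  have inN t : 0 < t < k -> f (step i0 t) \in A :|: B.
    move=> /andP[t_gt0 lt_tk]; have := others (step i0 t); rewrite negb_and !negbK.
    case/orP=> // /eqP/(congr1 val) /= /eqP; rewrite -{2}(modn_small (ltn_ord i0)).
    rewrite -{2}[nat_of_ord i0]addn0 eqn_modDl mod0n modn_small // => /eqP E.
    by rewrite E in t_gt0.
  have sameS t : t.+1 < k -> (f (step i0 t.+1) \in A) = (f (step i0 1) \in A).
    elim: t => [_|t IH lt_tk]; first by [].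
    rewrite -(IH (ltnW lt_tk)); apply: adj_same_side.
    - exact: inN.
    - by apply: inN; rewrite /= ltnW.
    - by rewrite adj_sym.
  have same t : 0 < t < k -> (f (step i0 t) \in A) = (f (step i0 1) \in A).
    by case: t => [//|t] /andP[_ lt_tk]; apply: sameS.
  have last_step : f i0 = f (step i0 k).
    by congr f; apply: val_inj; rewrite /= modnDr modn_small.
  have k1 : 0 < k.-1 < k by lia.
  have one : 0 < 1 < k by lia.
  have adj_1 : adj (f i0) (f (step i0 1)) by rewrite -{1}(step0 i0).
  have adj_k : adj (f i0) (f (step i0 k.-1)).
    by rewrite adj_sym last_step -{2}(prednK k_gt0).
  have ne_1k : f (step i0 1) != f (step i0 k.-1).
    rewrite (inj_eq f_inj); apply/eqP => /(congr1 val) /= /eqP.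
    by rewrite eqn_modDl !modn_small; lia.
  have detour w : inc w e -> f (step i0 1) \in star w :\ e ->
      f (step i0 k.-1) \in star w :\ e -> f i0 \notin star w :\ e -> False.
    rewrite !inE => we /andP[_ w1] /andP[_ wk] wN.
    apply: (no_detour w1 wk ne_1k _ adj_1 adj_k).
    apply: contra wN => ->; rewrite andbT; apply: contraNneq eNS => <-.
    by rewrite S1E imset_f.
  move: i0N; rewrite in_setU negb_or => /andP[i0A i0B].
  have [inA|NA] := boolP (f (step i0 1) \in A).
    by apply: (detour u ue inA _ i0A); rewrite same.
  have inB t : 0 < t < k -> f (step i0 t) \in B.
    by move=> t_k; have := inN t t_k; rewrite in_setU same // (negPf NA).
  by apply: (detour v ve _ _ i0B); apply: inB.
Qed.

(** The numbers a, b and c count the cycles inside A, inside B, and the others. *)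
Lemma cover_count k (F : {set subgraph (BCDC n)}) : 2 < k ->
  (forall S, S \in F -> is_subgraph S) ->
  (forall S, S \in F -> subgraph_iso (cycle_graph k) S) ->
  e \notin cover_vertices F -> A :|: B \subset cover_vertices F ->
  exists a b c, [/\ #|F| = a + b + c,
    2 * n.-1 <= k * (a + b) + (k - 2) * c,
    0 < a + b -> k <= n.-1 & c = 0 -> n.-1 <= k * a /\ n.-1 <= k * b].
Proof.
move=> k_gt2 F_sub F_iso eN N_sub.
have trace S : S \in F -> #|S.1| = k /\
  [\/ S.1 \subset A, S.1 \subset B | #|S.1 :&: (A :|: B)| + 2 <= k].
  move=> SF; apply: cycle_trace; auto.
  by apply: contra eN => eS; apply/bigcupP; exists S.
pose FA := [set S in F | S.1 \subset A].
pose FB := [set S in F | S.1 \subset B].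
pose FM := [set S in F | ~~ (S.1 \subset A) && ~~ (S.1 \subset B)].
have disjAB : [disjoint FA & FB].
  apply/pred0P => S /=; rewrite !inE; apply/negP.
  case/andP=> /andP[SF SA] /andP[_ SB]; have [cardS _] := trace S SF.
  have /card_gt0P[x xS] : 0 < #|S.1| by rewrite cardS; lia.
  exact: sides_disjoint (subsetP SA x xS) (subsetP SB x xS).
have cardF : #|F| = #|FA| + #|FB| + #|FM|.
  rewrite -(cardsUI FA FB).
  have -> : FA :&: FB = set0.
    by apply/setP => S; rewrite in_setI in_set0; apply: (pred0P disjAB).
  rewrite cards0 addn0.
  have <- : F :&: (FA :|: FB) = FA :|: FB.
    by apply/setP => S; rewrite !inE; case: (S \in F).
  have -> : FM = F :\: (FA :|: FB).
    apply/setP => S; rewrite !inE.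
    by case: (S \in F); rewrite //= ?andbT ?andbF ?negb_or.
  by rewrite cardsID.
have cardA := card_side ue; have cardB := card_side ve.
have cardN : #|A :|: B| = 2 * n.-1.
  have := cardsUI A B; rewrite cardA cardB addnn mul2n.
  have -> : A :&: B = set0.
    apply/setP => x; rewrite in_setI in_set0; apply/negP => /andP[].
    exact: sides_disjoint.
  by rewrite cards0 addn0.
exists #|FA|, #|FB|, #|FM|; split => //.
- rewrite -cardN.
  have sub : A :|: B \subset
      \bigcup_(S in FA :|: FB) S.1 :|: \bigcup_(S in FM) (S.1 :&: (A :|: B)).
    apply/subsetP => x xN; have /bigcupP[S SF xS] := subsetP N_sub x xN.
    rewrite in_setU; have [SAB|SM] := boolP (S \in FA :|: FB).
      by apply/orP; left; apply/bigcupP; exists S.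
    apply/orP; right; apply/bigcupP; exists S; last by rewrite in_setI xS.
    by move: SM; rewrite !inE SF negb_or.
  apply: leq_trans (subset_leq_card sub) _; apply: leq_trans (leq_card_setU _ _) _.
  apply: leq_add.
    rewrite -(cardsUI FA FB).
    apply: leq_trans (leq_card_bigcup (c := k) _) _ => [S|].
      by rewrite !inE => /orP[] /andP[/trace[->]].
    by rewrite leq_mul2l leq_addr orbT.
  apply: leq_card_bigcup => S; rewrite inE.
  case/andP=> /trace[_ [->|->|le]]; rewrite ?andbF //.
  by move=> _; rewrite leq_subRL ?(ltnW k_gt2) // addnC.
- rewrite addn_gt0 => /orP[] /card_gt0P[S];
    rewrite inE => /andP[/trace[<- _]] /subset_leq_card.
    by rewrite cardA.
  by rewrite cardB.
move/eqP; rewrite cards_eq0 => /eqP FM0.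
have pure S : S \in F -> S.1 \subset A \/ S.1 \subset B.
  move=> SF; have : S \notin FM by rewrite FM0 inE.
  by rewrite !inE SF /= -negb_or negbK => /orP[]; [left|right].
have cover_side (P P' : {set BCDC n}) : (forall x, x \in P -> x \in P' -> False) ->
    (forall S, S \in F -> S.1 \subset P \/ S.1 \subset P') -> P \subset A :|: B ->
    #|P| <= k * #|[set S in F | S.1 \subset P]|.
  move=> disj pureP subP; apply: leq_trans (leq_card_bigcup (F := fst) _); last first.
    by move=> S; rewrite inE => /andP[/trace[->]].
  apply/subset_leq_card/subsetP => x xP.
  have /bigcupP[S SF xS] := subsetP N_sub x (subsetP subP x xP).
  apply/bigcupP; exists S => //; rewrite inE SF.
  by case: (pureP S SF) => // /subsetP/(_ x xS)/(disj x xP).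
split; [rewrite -cardA|rewrite -cardB].
  by apply: (cover_side A B sides_disjoint pure); apply: subsetUl.
apply: (cover_side B A) (subsetUr _ _) => [x xB xA|S /pure[]]; [|right|left] => //.
exact: sides_disjoint xA xB.
Qed.

Lemma side_end w x a : (w == u) || (w == v) -> x \in star w :\ e -> inc a x -> a != w ->
  [/\ CQ_adj w a, a != u & a != v].
Proof.
move=> w_uv; rewrite !inE => /andP[ne_xe wx] ax ne_aw.
have wa : CQ_adj w a by apply: inc_adj ax; rewrite // eq_sym.
have aNe : ~~ inc a e.
  apply: contra ne_xe => ae; apply/eqP/(inc_inj n_gt1 ne_aw) => //.
  by rewrite ends_e.
by move: aNe; rewrite ends_e negb_or => /andP[].
Qed.

(** The cycle runs through T1 from x2 to x1, the edge a1 b1, T2 from y1 to y2 and the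
    edge a2 b2. *)
Lemma kcycle_across (T1 T2 : {set BCDC n}) x1 x2 y1 y2 a1 a2 b1 b2 :
    T1 \subset A -> x1 \in T1 -> x2 \in T1 ->
    T2 \subset B -> y1 \in T2 -> y2 \in T2 ->
    inc a1 x1 -> inc a2 x2 -> inc b1 y1 -> inc b2 y2 ->
    a1 != u -> a2 != u -> b1 != v -> b2 != v -> a1 != a2 -> b1 != b2 ->
    CQ_adj a1 b1 -> CQ_adj a2 b2 ->
  exists C, [/\ kcycle (#|T1| + #|T2| + 2) C, e \notin C & T1 :|: T2 \subset C].
Proof.
move=> sT1 x1T x2T sT2 y1T y2T ax1 ax2 by1 by2 a1u a2u b1v b2v ne_a ne_b ab1 ab2.
have u_uv : (u == u) || (u == v) by rewrite eqxx.
have v_uv : (v == u) || (v == v) by rewrite eqxx orbT.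
have [ua1 _ a1v] := side_end u_uv (subsetP sT1 _ x1T) ax1 a1u.
have [ua2 _ a2v] := side_end u_uv (subsetP sT1 _ x2T) ax2 a2u.
have [vb1 b1u _] := side_end v_uv (subsetP sT2 _ y1T) by1 b1v.
have [vb2 b2u _] := side_end v_uv (subsetP sT2 _ y2T) by2 b2v.
have [z1 ends1] := edge_exists n_gt1 ab1; have [z2 ends2] := edge_exists n_gt1 ab2.
have off z : ~~ inc u z -> ~~ inc v z -> z \notin e |: (T1 :|: T2).
  move=> uN vN; rewrite !in_setU in_set1 !negb_or; apply/and3P; split.
  - by apply: contraNneq uN => ->; apply: ue.
  - by apply: contra uN => /(subsetP sT1); rewrite !inE => /andP[].
  - by apply: contra vN => /(subsetP sT2); rewrite !inE => /andP[].
have off1 : z1 \notin e |: (T1 :|: T2).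
  by apply: off; rewrite ends1 negb_or ![_ == a1]eq_sym ![_ == b1]eq_sym ?a1u ?a1v ?b1u.
have off2 : z2 \notin e |: (T1 :|: T2).
  by apply: off; rewrite ends2 negb_or ![_ == a2]eq_sym ![_ == b2]eq_sym ?a2u ?a2v ?b2u.
have side_inc w (T : {set BCDC n}) x : T \subset star w :\ e -> x \in T -> inc w x.
  by move=> /subsetP sub /sub; rewrite !inE => /andP[].
have ne_x : x2 != x1.
  rewrite eq_sym; apply: (edge_neq n_gt1 _ _ ax1 ax2 a1u a2u ne_a).
    exact: side_inc sT1 x1T.
  exact: side_inc sT1 x2T.
have ne_y : y1 != y2.
  apply: (edge_neq n_gt1 _ _ by1 by2 b1v b2v ne_b).
    exact: side_inc sT2 y1T.
  exact: side_inc sT2 y2T.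
have ne_z : z1 != z2.
  apply/eqP => eq_z; have := ends2 a1; rewrite -eq_z ends1 eqxx (negPf ne_a) /=.
  move/esym/eqP=> eq_ab; apply: (@CQ_triangle_free _ u v a1) => //.
  by rewrite eq_ab.
have disj : [disjoint T1 & T2].
  apply/pred0P => z /=; apply/negP => /andP[/(subsetP sT1) zA /(subsetP sT2) zB].
  exact: sides_disjoint zA zB.
exists (T1 :|: T2 :|: [set z in [:: z1] ++ [:: z2]]); split.
- rewrite -[2]/(1 + 1) addnA.
  have cl1 : clique T1.
    by apply: (@star_clique u); apply: subset_trans sT1 (subsetDl _ _).
  have cl2 : clique T2.
    by apply: (@star_clique v); apply: subset_trans sT2 (subsetDl _ _).
  have := @kcycle_bridge _ T1 T2 x2 x1 y1 y2 [:: z1] [:: z2]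
    cl1 x2T x1T ne_x cl2 y1T y2T ne_y disj.
  apply => /=.
  + by rewrite inE ne_z.
  + by move=> z; rewrite !inE => /orP[] /eqP->; [move: off1|move: off2];
      rewrite !inE !negb_or => /andP[].
  + rewrite andbT; apply/andP; split.
      apply: (inc_clique n_gt1 ax1); first by rewrite ends1 eqxx.
      by apply: contraNneq off1 => <-; rewrite !inE x1T orbT.
    apply: (inc_clique n_gt1 _ by1); first by rewrite ends1 eqxx orbT.
    by apply: contraNneq off1 => ->; rewrite !inE y1T !orbT.
  + rewrite andbT; apply/andP; split.
      apply: (inc_clique n_gt1 by2); first by rewrite ends2 eqxx orbT.
      by apply: contraNneq off2 => <-; rewrite !inE y2T !orbT.
    apply: (inc_clique n_gt1 _ ax2); first by rewrite ends2 eqxx.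
    by apply: contraNneq off2 => ->; rewrite !inE x2T orbT.
- rewrite !in_setU !negb_or; apply/andP; split.
    by apply/andP; split; apply/negP; [move/(subsetP sT1)|move/(subsetP sT2)];
       rewrite !inE eqxx.
  rewrite !inE negb_or; apply/andP; split; apply/eqP => eq_e.
    by move: off1; rewrite -eq_e !inE eqxx.
  by move: off2; rewrite -eq_e !inE eqxx.
- exact: subsetUl.
Qed.

(** The cycle runs through T from x0 to x1 and returns through d edges at c, starting
    with a1 c and ending with a0 c. *)
Lemma kcycle_handle (T : {set BCDC n}) x0 x1 a0 a1 c d :
    T \subset A -> x0 \in T -> x1 \in T -> inc a0 x0 -> inc a1 x1 ->
    a0 != u -> a1 != u -> a0 != a1 -> c != u -> CQ_adj a0 c -> CQ_adj a1 c ->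
    1 < d <= n ->
  exists C, [/\ kcycle (#|T| + d) C, e \notin C & T \subset C].
Proof.
move=> sT x0T x1T ax0 ax1 a0u a1u ne_a ne_cu ac0 ac1 d_n.
have u_uv : (u == u) || (u == v) by rewrite eqxx.
have [ua0 _ a0v] := side_end u_uv (subsetP sT _ x0T) ax0 a0u.
have [ua1 _ a1v] := side_end u_uv (subsetP sT _ x1T) ax1 a1u.
have cv : c != v.
  apply/eqP => eq_cv; subst c.
  exact: (CQ_triangle_free ua0 uv ac0).
have [h0 ends0] := edge_exists n_gt1 ac0; have [h1 ends1] := edge_exists n_gt1 ac1.
have h0c : inc c h0 by rewrite ends0 eqxx orbT.
have h1c : inc c h1 by rewrite ends1 eqxx orbT.
have ne_h : h1 != h0.
  apply/eqP => eq_h; have := ends0 a1.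
  rewrite -eq_h ends1 eqxx /= eq_sym (negPf ne_a) /=.
  by move/esym/eqP=> eq_ac; rewrite eq_ac CQ_irr in ac1.
have sub_h : [set h0; h1] \subset star c.
  by apply/subsetP => x; rewrite !inE => /orP[] /eqP->.
have [|D [sub_D sDc card_D]] := @subset_between _ _ _ d sub_h.
  by rewrite card_star // cards2 eq_sym ne_h.
have h0D : h0 \in D by apply: (subsetP sub_D); rewrite !inE eqxx.
have h1D : h1 \in D by apply: (subsetP sub_D); rewrite !inE eqxx orbT.
have uND z : z \in D -> ~~ inc u z.
  move/(subsetP sDc); rewrite inE => cz; apply/negP => uz.
  have cu := inc_adj n_gt1 ne_cu cz uz.
  by apply: (CQ_triangle_free ua0 _ ac0); rewrite CQ_sym.
have T_u z : z \in T -> inc u z by move/(subsetP sT); rewrite !inE => /andP[].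
have disj : [disjoint T & D].
  apply/pred0P => z /=; apply/negP => /andP[/T_u uz /uND]; by rewrite uz.
have ne_x : x0 != x1.
  by apply: (edge_neq n_gt1 _ _ ax0 ax1 a0u a1u ne_a); apply: T_u.
exists (T :|: D :|: [set z in [::] ++ [::]]); split.
- rewrite -card_D -[X in kcycle X _]addn0 -[X in kcycle X _]addn0.
  have cl1 : clique T by apply: (@star_clique u); apply: subset_trans sT (subsetDl _ _).
  apply: (@kcycle_bridge _ T D x0 x1 h1 h0 [::] [::]) => //=.
  + exact: star_clique sDc.
  + rewrite andbT; apply: (inc_clique n_gt1 ax1); first by rewrite ends1 eqxx.
    by apply: contraTneq (T_u _ x1T) => ->; apply: uND.
  + rewrite andbT; apply: (inc_clique n_gt1 _ ax0); first by rewrite ends0 eqxx.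
    by apply: contraTneq (T_u _ x0T) => <-; apply: uND.
- rewrite !in_setU !negb_or -andbA; apply/and3P; split; last by rewrite inE.
    by apply/negP => /(subsetP sT); rewrite !inE eqxx.
  by apply/negP => /uND; rewrite ue.
- by rewrite -setUA subsetUl.
Qed.

End CyclesAroundAnEdge.

(** * A ladder in the crossed cube *)

(** A string given by its bits as a function of the position. *)
Fixpoint of_bits n (f : nat -> bool) : bits n :=
  if n is m.+1 then [tuple of f m :: of_bits m f] else [tuple].

Lemma bit_of_bits n f j : j < n -> bit (of_bits n f) j = f j.
Proof.
elim: n => // n IH; rewrite ltnS leq_eqVlt /= => /predU1P[->|lt_jn].
  by rewrite /bit /= rev_cons nth_rcons size_rev size_tuple ltnn eqxx.
by rewrite bit_cons // IH.
Qed.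

(** Removing the common bits above position i leads to a copy of the crossed cube
    where the two strings have different leading bits. *)
Lemma CQ_adj_of_bits n i (f g : nat -> bool) : i < n -> f i != g i ->
  (forall j, i < j -> g j = f j) ->
  (forall j, j < i -> g j = f j (+) (odd j && f j.-1)) ->
  CQ_adj (of_bits n f) (of_bits n g).
Proof.
move=> lt_in ne_i above below.
elim: n lt_in => // n IH; rewrite ltnS leq_eqVlt CQ_adj_cons => /predU1P[i_n|lt_in].
  rewrite -i_n (negPf ne_i); apply/eqP/eq_bits => j lt_ji.
  by rewrite bit_twist // !bit_of_bits ?below //; lia.
by rewrite above // eqxx IH.
Qed.

Definition ones n (s : seq nat) : bits n := of_bits n (mem s).

(** The configuration near the end u of the edge uv: three other neighbours of u, and a
    vertex c that closes the 4-cycle u, a0, c, a1. *)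
Definition ladder_end n (u v a0 a1 a2 c : bits n) :=
  [/\ [&& CQ_adj u a0, CQ_adj u a1 & CQ_adj u a2],
      CQ_adj a0 c && CQ_adj a1 c & uniq [:: u; v; a0; a1; a2; c]].

(** With e_i the string whose only nonzero bit is at position i, and m = n-1 the leading
    position, take u = 0, v = e_m, a0 = e_0, a1 = e_1, a2 = e_3, c = e_0 + e_1, and add e_m
    to get the vertices near v.  The string e_i is matched with e_i + e_m when i is odd,
    which is why a1 and a2 use the positions 1 and 3; this needs n >= 5. *)
Lemma ladder_exists n : 4 < n -> exists u v a0 a1 a2 b0 b1 b2 c d : bits n,
  [/\ CQ_adj u v, ladder_end u v a0 a1 a2 c, ladder_end v u b0 b1 b2 d,
      CQ_adj a1 b1 & CQ_adj a2 b2].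
Proof.
case: n => // m m_gt3.
have adj s t i : i <= m -> (i \in s) != (i \in t) ->
    (forall j, i < j -> (j \in t) = (j \in s)) ->
    (forall j, j < i -> (j \in t) = (j \in s) (+) (odd j && (j.-1 \in s))) ->
  CQ_adj (ones m.+1 s) (ones m.+1 t).
  by move=> *; apply: (@CQ_adj_of_bits _ i).
(* The bits that tell the vertices of the ladder apart. *)
pose code (w : bits m.+1) := [:: bit w 0; bit w 1; bit w 3; bit w m].
have codeE s : code (ones m.+1 s) = [:: 0 \in s; 1 \in s; 3 \in s; m \in s].
  by rewrite /code !bit_of_bits //; lia.
have [m0 m1 m3] : [/\ m == 0 = false, m == 1 = false & m == 3 = false] by split; lia.
have uniqE (ss : seq (seq nat)) :
    uniq [seq [:: 0 \in s; 1 \in s; 3 \in s; m \in s] | s <- ss] ->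
    uniq [seq ones m.+1 s | s <- ss].
  by move=> ss_uniq; apply: (@map_uniq _ _ code); rewrite -map_comp (eq_map codeE).
exists (ones _ [::]), (ones _ [:: m]).
exists (ones _ [:: 0]), (ones _ [:: 1]), (ones _ [:: 3]).
exists (ones _ [:: 0; m]), (ones _ [:: 1; m]), (ones _ [:: 3; m]).
exists (ones _ [:: 0; 1]), (ones _ [:: 0; 1; m]).
split; [|split|split| |].
- by apply: (adj _ _ m) => *; rewrite ?(in_nil, inE); lia.
- apply/and3P; split; [apply: (adj _ _ 0)|apply: (adj _ _ 1)|apply: (adj _ _ 3)];
    move=> *; rewrite ?(in_nil, inE); lia.
- apply/andP; split; [apply: (adj _ _ 1)|apply: (adj _ _ 0)];
    move=> *; rewrite ?(in_nil, inE); lia.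
- apply: (uniqE [:: [::]; [:: m]; [:: 0]; [:: 1]; [:: 3]; [:: 0; 1]]).
  by rewrite /= !inE ![_ == m]eq_sym !m0 !m1 !m3 eqxx.
- apply/and3P; split; [apply: (adj _ _ 0)|apply: (adj _ _ 1)|apply: (adj _ _ 3)];
    move=> *; rewrite ?(in_nil, inE); lia.
- apply/andP; split; [apply: (adj _ _ 1)|apply: (adj _ _ 0)];
    move=> *; rewrite ?(in_nil, inE); lia.
- apply: (uniqE [:: [:: m]; [::]; [:: 0; m]; [:: 1; m]; [:: 3; m]; [:: 0; 1; m]]).
  by rewrite /= !inE ![_ == m]eq_sym !m0 !m1 !m3 eqxx.
- by apply: (adj _ _ m) => *; rewrite ?(in_nil, inE); lia.
- by apply: (adj _ _ m) => *; rewrite ?(in_nil, inE); lia.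
Qed.

Lemma ladder_end_neq n (u v a0 a1 a2 c : bits n) : ladder_end u v a0 a1 a2 c ->
  [/\ a0 != u, a1 != u & a2 != u] /\ [/\ a0 != a1, a1 != a2 & c != u].
Proof.
case=> _ _; rewrite /= !inE !negb_or.
case/and5P=> /and5P[_ ne_u0 ne_u1 ne_u2 ne_uc] _ /and3P[ne_01 _ _] /andP[ne_12 _] _.
by rewrite ![_ == u]eq_sym.
Qed.

Lemma side_edges n (e : BCDC n) (u v a0 a1 a2 c : bits n) : 1 < n ->
    (forall w, inc w e = (w == u) || (w == v)) -> ladder_end u v a0 a1 a2 c ->
  exists x0 x1 x2, [/\ [set x0; x1; x2] \subset star u :\ e, uniq [:: x0; x1; x2],
    inc a0 x0, inc a1 x1 & inc a2 x2].
Proof.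
move=> n_gt1 ends_e [/and3P[ua0 ua1 ua2] _ /= uniq_l].
move: uniq_l; rewrite !inE !negb_or.
case/and5P=> /and5P[_ ne_u0 ne_u1 ne_u2 _] /and4P[ne_v0 ne_v1 ne_v2 _].
case/and3P=> ne_01 ne_02 _ /andP[ne_12 _] _.
have [x0 ends0] := edge_exists n_gt1 ua0.
have [x1 ends1] := edge_exists n_gt1 ua1.
have [x2 ends2] := edge_exists n_gt1 ua2.
have [i0 i1 i2] : [/\ inc a0 x0, inc a1 x1 & inc a2 x2].
  by rewrite ends0 ends1 ends2 !eqxx !orbT.
have [j0 j1 j2] : [/\ inc u x0, inc u x1 & inc u x2].
  by rewrite ends0 ends1 ends2 !eqxx.
have off a x : inc a x -> u != a -> v != a -> x != e.
  move=> ax ua va; apply: contraTneq ax => ->.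
  by rewrite ends_e negb_or ![a == _]eq_sym ua.
exists x0, x1, x2; split=> //.
  apply/subsetP => x; rewrite !inE -orbA.
  by case/or3P=> /eqP->; rewrite ?j0 ?j1 ?j2 andbT;
    [apply: (off a0)|apply: (off a1)|apply: (off a2)].
have nu a : u != a -> a != u by rewrite eq_sym.
by rewrite /= !inE negb_or !andbT (edge_neq n_gt1 j0 j1 i0 i1)
  ?(edge_neq n_gt1 j0 j2 i0 i2) ?(edge_neq n_gt1 j1 j2 i1 i2) ?nu.
Qed.

(** * The number of cycles *)

Definition cycle_number n k :=
  let r := (n - 1) %% k in
  if ((6 <= k <= n - 1) && (1 <= r <= k %/ 2 - 1)) || (k == 2 * n)
  then 2 * ceil_div (n - 1) k - 1
  else if k == n then 3
  else 2 * ceil_div (n - 1) k.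

(** The ways of covering two disjoint cliques A and B of n.-1 elements by the required
    number of cycles.
    - [PlanMixed]: one cycle across covers h elements of A and at least as many of B; the
      rest of A takes q cycles inside A, and likewise for B;
    - [PlanPure]: q.+1 cycles inside A and q.+1 inside B; by the last inequality, a cycle
      across would not make one of them superfluous;
    - [PlanSpan]: one cycle runs through all of A and B;
    - [PlanThree]: a cycle of length n is too short to contain A and two vertices
      outside, so one element of A and one of B are left for a third cycle;
    - [PlanTwo]: a cycle contains A, another one contains B. *)
Variant cover_plan n k : Prop :=
| PlanMixed q h of k <= n.-1 & 1 < h & h + h + 2 <= k & q * k < n.-1 <= q * k + h
    & cycle_number n k = 1 + (q + q)
| PlanPure q of k <= n.-1 & n.-1 <= q.+1 * k & (q + q.+1) * k < 2 * n
    & cycle_number n k = q.+1 + q.+1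
| PlanSpan of k = 2 * n & cycle_number n k = 1
| PlanThree of k = n & cycle_number n k = 1 + (1 + 1)
| PlanTwo of n < k < 2 * n & cycle_number n k = 1 + 1.

Lemma cover_planP n k : 4 < n -> 6 <= k <= 2 * n -> cover_plan n k.
Proof.
move=> n_gt4 /andP[k_ge6 k_le2n]; have k_gt0 : 0 < k by apply: leq_trans k_ge6.
have [k_lt_n|k_ge_n] := ltnP k n; last first.
  have ceil1 : ceil_div (n - 1) k = 1.
    by apply/eqP; rewrite eqn_leq ltnNge !ceil_divP //; lia.
  have numE : cycle_number n k = if k == 2 * n then 1 else if k == n then 3 else 2.
    rewrite /cycle_number ceil1; have -> : 6 <= k <= n - 1 = false by lia.
    by [].
  have [k2n|k_ne2n] := eqVneq k (2 * n).
    by apply: PlanSpan; rewrite ?numE ?k2n ?eqxx.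
  have [kn|k_nen] := eqVneq k n.
    by apply: PlanThree => //; rewrite numE (negPf k_ne2n) {1}kn eqxx.
  by apply: PlanTwo; [lia|rewrite numE (negPf k_ne2n) (negPf k_nen)].
have n1E := divn_eq (n - 1) k; have lt_r := ltn_pmod (n - 1) k_gt0.
have numE : cycle_number n k = if 1 <= (n - 1) %% k <= k %/ 2 - 1
    then 2 * ceil_div (n - 1) k - 1 else 2 * ceil_div (n - 1) k.
  rewrite /cycle_number; have -> : 6 <= k <= n - 1 by lia.
  have -> : (k == 2 * n) = false by lia.
  have -> : (k == n) = false by lia.
  by rewrite orbF.
have [r0|r_gt0] := posnP ((n - 1) %% k).
  have [q qE] : exists q, (n - 1) %/ k = q.+1.
    by exists ((n - 1) %/ k).-1; rewrite prednK // divn_gt0; clear -k_lt_n k_gt0; lia.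
  have ceilE : ceil_div (n - 1) k = q.+1.
    apply/eqP; rewrite eqn_leq ltnNge !ceil_divP // n1E r0 qE addn0 leqnn.
    by rewrite mulSn -ltnNge -[ltnLHS]add0n ltn_add2r.
  rewrite r0 /= ceilE in numE; rewrite r0 qE addn0 in n1E.
  apply: (@PlanPure _ _ q); first by clear -k_lt_n; lia.
  - by rewrite -n1E subn1.
  - by rewrite mulnDl -n1E; rewrite mulSn in n1E; clear -n1E k_gt0 n_gt4; lia.
  - by rewrite numE addnn mul2n.
have ceilE : ceil_div (n - 1) k = ((n - 1) %/ k).+1.
  apply/eqP; rewrite eqn_leq ltnNge !ceil_divP // mulSn.
  by move: (_ * k) n1E => Q n1E; clear -n1E lt_r r_gt0; lia.
rewrite ceilE r_gt0 andTb in numE.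
case: ifP numE => [r_le numE|r_big numE]; last first.
  apply: (@PlanPure _ _ ((n - 1) %/ k)); first by clear -k_lt_n; lia.
  - by rewrite mulSn; move: (_ * k) n1E => Q n1E; clear -n1E lt_r; lia.
  - rewrite mulnDl mulSn; move: (_ * k) n1E r_big => Q n1E r_big.
    by clear -n1E r_big; lia.
  - by rewrite numE addnn mul2n.
apply: (@PlanMixed _ _ ((n - 1) %/ k) (k %/ 2 - 1)).
- lia.
- by clear -k_ge6; lia.
- by clear -k_ge6; lia.
- by move: (_ * k) n1E => Q n1E; clear -n1E r_gt0 r_le; lia.
- by rewrite numE; lia.
Qed.

(** The last three hypotheses provide the cycles across and those with a handle.  The
    latter need not pass through x2 and y2, which are the elements that they leave out
    when k = n; the cycle across then covers both. *)
Lemma coverable_two_sides (G : sgraph) n k (e : G) (A B : {set G}) x0 x1 x2 y0 y1 y2 :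
    4 < n -> 6 <= k <= 2 * n ->
    #|A| = n.-1 -> #|B| = n.-1 -> clique A -> clique B -> e \notin A -> e \notin B ->
    [set x0; x1; x2] \subset A -> uniq [:: x0; x1; x2] ->
    [set y0; y1; y2] \subset B -> uniq [:: y0; y1; y2] ->
    (forall T1 T2 : {set G}, T1 \subset A -> [set x1; x2] \subset T1 ->
      T2 \subset B -> [set y1; y2] \subset T2 -> #|T1| + #|T2| + 2 = k ->
      coverable k e 1 (T1 :|: T2)) ->
    (forall T : {set G}, T \subset A -> [set x0; x1] \subset T ->
      1 < k - #|T| <= n -> coverable k e 1 T) ->
    (forall T : {set G}, T \subset B -> [set y0; y1] \subset T ->
      1 < k - #|T| <= n -> coverable k e 1 T) ->
  coverable k e (cycle_number n k) (A :|: B).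
Proof.
move=> n_gt4 k_bd cardA cardB clA clB eNA eNB sX uniqX sY uniqY.
move=> across handleA handleB.
have [X12 Y12] : [set x1; x2] \subset A /\ [set y1; y2] \subset B.
  by split; [apply: subset_trans sX|apply: subset_trans sY]; rewrite -setUA subsetUr.
have [X01 Y01] : [set x0; x1] \subset A /\ [set y0; y1] \subset B.
  by split; [apply: subset_trans sX|apply: subset_trans sY]; rewrite subsetUl.
have [cardX12 cardY12] : #|[set x1; x2]| = 2 /\ #|[set y1; y2]| = 2.
  move: uniqX uniqY; rewrite /= !inE => /and3P[_ neX _] /and3P[_ neY _].
  by rewrite !cards2 neX neY.
have k_gt1 : 1 < k by case/andP: k_bd => /ltnW/ltnW/ltnW/ltnW.
have side_cover (K T : {set G}) m : k <= #|K| -> clique K -> e \notin K ->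
    T \subset K -> #|T| <= m * k -> coverable k e m T.
  by move=> le_kK clK eNK; apply: coverable_clique; rewrite // k_gt1.
case: (cover_planP n_gt4 k_bd).
- move=> q h k_le h_gt1 le_hk /andP[_ le_nqk] ->.
  have [|T1 [X12T1 sT1A cardT1]] := @subset_between _ _ _ h X12.
    by rewrite cardX12 cardA h_gt1; clear -k_le le_hk; lia.
  have [|T2 [Y12T2 sT2B cardT2]] := @subset_between _ _ _ (k - 2 - h) Y12.
    by rewrite cardY12 cardB; clear -h_gt1 k_le le_hk; lia.
  apply: (@coverable_sub _ _ _ _ _ ((T1 :|: T2) :|: ((A :\: T1) :|: (B :\: T2)))).
    apply/subsetP => x; rewrite !in_setU !in_setD.
    by case: (x \in T1); case: (x \in T2); rewrite ?orbT.
  apply: coverableU.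
    by apply: across => //; rewrite cardT1 cardT2; clear -le_hk; lia.
  apply: coverableU; [apply: (side_cover A)|apply: (side_cover B)];
    rewrite ?cardA ?cardB ?subsetDl // cardsD.
    by rewrite (setIidPr sT1A) cardA cardT1; clear -le_nqk; lia.
  by rewrite (setIidPr sT2B) cardB cardT2; clear -le_nqk le_hk; lia.
- move=> q k_le le_nqk _ ->; apply: coverableU.
    by apply: (side_cover A); rewrite ?cardA.
  by apply: (side_cover B); rewrite ?cardB.
- by move=> k2n ->; apply: across; rewrite // cardA cardB k2n; clear -n_gt4; lia.
- move=> kn ->; rewrite kn in k_bd.
  have [|T1 [X12T1 sT1A cardT1]] := @subset_between _ _ _ 2 X12.
    by rewrite cardX12 cardA; clear -n_gt4; lia.
  have [|T2 [Y12T2 sT2B cardT2]] := @subset_between _ _ _ (n - 4) Y12.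
    by rewrite cardY12 cardB; clear -k_bd; lia.
  apply: (@coverable_sub _ _ _ _ _ ((T1 :|: T2) :|: ((A :\ x2) :|: (B :\ y2)))).
    have x2T1 : x2 \in T1 by apply: (subsetP X12T1); rewrite !inE eqxx orbT.
    have y2T2 : y2 \in T2 by apply: (subsetP Y12T2); rewrite !inE eqxx orbT.
    apply/subsetP => x; rewrite !in_setU !in_setD1 => xAB.
    have [->|_] := eqVneq x x2; first by rewrite x2T1.
    have [->|_] := eqVneq x y2; first by rewrite y2T2 orbT.
    by rewrite !andTb xAB orbT.
  have [x2A y2B] : x2 \in A /\ y2 \in B.
    by split; [apply: (subsetP X12)|apply: (subsetP Y12)]; rewrite !inE eqxx orbT.
  have := cardsD1 x2 A; have := cardsD1 y2 B.
  rewrite cardA cardB x2A y2B => cardB' cardA'.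
  move: uniqX uniqY; rewrite /= !inE !negb_or.
  case/and3P=> /andP[_ ne_x02] ne_x12 _ /and3P[/andP[_ ne_y02] ne_y12 _].
  apply: coverableU.
    by apply: across => //; rewrite cardT1 cardT2 kn; clear -k_bd; lia.
  apply: coverableU; [apply: handleA|apply: handleB]; rewrite ?subsetDl ?kn //.
  + by rewrite subsetD1 X01 !inE negb_or ![x2 == _]eq_sym ne_x02.
  + by clear -k_bd cardA'; lia.
  + by rewrite subsetD1 Y01 !inE negb_or ![y2 == _]eq_sym ne_y02.
  + by clear -k_bd cardB'; lia.
- move=> k_n ->; apply: coverableU; [apply: handleA|apply: handleB] => //.
    by rewrite cardA; clear -k_n n_gt4; lia.
  by rewrite cardB; clear -k_n n_gt4; lia.
Qed.

(** If c > 0, the cycles cover at most k * (a + b + c) - 2 elements of A and B; if c = 0,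
    both k * a and k * b have to reach n.-1, so rounding up is done twice. *)
Lemma cycle_number_leq n k a b c : 4 < n -> 6 <= k <= 2 * n ->
    2 * n.-1 <= k * (a + b) + (k - 2) * c -> (0 < a + b -> k <= n.-1) ->
    (c = 0 -> n.-1 <= k * a /\ n.-1 <= k * b) ->
  cycle_number n k <= a + b + c.
Proof.
move=> n_gt4 k_bd count pure unmixed.
have total : 2 * n.-1 <= k * (a + b + c).
  apply: leq_trans count _.
  by rewrite [k * (_ + c)]mulnDr leq_add2l leq_mul2r leq_subr orbT.
have big : n.-1 < k -> a + b = 0 /\ 2 * n.-1 <= (k - 2) * c.
  case: posnP pure => [ab0 _ _|_ /(_ isT) k_le]; last by rewrite ltnNge k_le.
  by move: count; rewrite ab0 muln0.
case: (cover_planP n_gt4 k_bd) => [q h k_le _ _ /andP[q_lt _] ->|q k_le _ q_lt ->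
    |k2n ->|kn ->|/andP[k_gt k_lt] ->].
- rewrite ltnNge; apply/negP => /(leq_mul (leqnn k)).
  by rewrite (mulnC k (q + q)) mulnDl; clear -total q_lt; lia.
- have [c0|c_gt0] := posnP c.
    have q_lt_side x : n.-1 <= k * x -> q < x.
      move=> le_x; rewrite ltnNge; apply/negP => /(leq_mul (leqnn k)).
      by move: q_lt; rewrite mulnDl mulSn (mulnC k q); clear -le_x k_bd; lia.
    have [le_a le_b] := unmixed c0.
    by rewrite c0 addn0 leq_add ?q_lt_side.
  rewrite addSn ltnNge; apply/negP => /(leq_mul (leqnn k)).
  have : k * (a + b) + (k - 2) * c + 2 <= k * (a + b + c).
    by rewrite [k * (_ + c)]mulnDr -addnA leq_add2l mulnBl; clear -c_gt0 k_bd; nia.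
  by rewrite (mulnC k (_ + q.+1)); clear -q_lt count n_gt4; lia.
- by case: (a + b + c) total => //; rewrite muln0; clear -n_gt4; lia.
- have [|-> count_c] := big; first by clear -kn n_gt4; lia.
  rewrite add0n; case: c count_c {big count unmixed total} => [|[|[|//]]];
    by rewrite kn; clear -n_gt4; lia.
- have [|-> count_c] := big; first by clear -k_gt n_gt4; lia.
  rewrite add0n; case: c count_c {big count unmixed total} => [|[|//]];
    by clear -k_lt n_gt4; lia.
Qed.

Lemma cycle_number_leq_large n k m : 4 < n -> 6 <= k <= 2 * n ->
  3 * n - 4 <= k * m -> cycle_number n k <= m.
Proof.
move=> n_gt4 k_bd count.
have total : 2 * n <= k * m + 1 by clear -n_gt4 count; lia.
case: (cover_planP n_gt4 k_bd) => [q h k_le _ _ /andP[q_lt _] ->|q k_le _ q_lt ->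
    |k2n ->|kn ->|/andP[k_gt k_lt] ->].
- rewrite ltnNge; apply/negP => /(leq_mul (leqnn k)).
  by rewrite (mulnC k (q + q)) mulnDl; clear -total q_lt; lia.
- rewrite addSn ltnNge; apply/negP => /(leq_mul (leqnn k)).
  by rewrite (mulnC k (_ + q.+1)); clear -q_lt count n_gt4; lia.
- by case: m count {total} => //; rewrite muln0; clear -n_gt4; lia.
- by case: m count {total} => [|[|[|//]]]; rewrite kn; clear -n_gt4; lia.
- by case: m count {total} => [|[|//]]; clear -k_lt n_gt4; lia.
Qed.

(** * The structure connectivity *)

Lemma cycle_cover n k : 4 < n -> 6 <= k <= 2 * n -> exists (e : BCDC n) (u v : bits n),
  [/\ CQ_adj u v, forall w, inc w e = (w == u) || (w == v)
    & coverable k e (cycle_number n k) (star u :\ e :|: star v :\ e)].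
Proof.
move=> n_gt4 /andP[k_ge6 k_le2n]; have n_gt1 : 1 < n by lia.
have [u [v [a0 [a1 [a2 [b0 [b1 [b2 [c [d]]]]]]]]]] := ladder_exists n_gt4.
case=> uv lad_u lad_v ab1 ab2.
have [e ends_e] := edge_exists n_gt1 uv.
have vu : CQ_adj v u by rewrite CQ_sym.
have ends_e' w : inc w e = (w == v) || (w == u) by rewrite ends_e orbC.
exists e, u, v; split=> //.
have [x0 [x1 [x2 [sX uniqX ax0 ax1 ax2]]]] := side_edges n_gt1 ends_e lad_u.
have [y0 [y1 [y2 [sY uniqY by0 by1 by2]]]] := side_edges n_gt1 ends_e' lad_v.
have cardA : #|star u :\ e| = n.-1 by apply: (card_side n_gt1); rewrite ends_e eqxx.
have cardB : #|star v :\ e| = n.-1.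
  by apply: (card_side n_gt1); rewrite ends_e eqxx orbT.
have [clA clB] : clique (star u :\ e) /\ clique (star v :\ e).
  by split; apply: star_clique (subsetDl _ _).
have [eNA eNB] : e \notin star u :\ e /\ e \notin star v :\ e by rewrite !inE eqxx.
apply: (@coverable_two_sides _ n k e _ _ x0 x1 x2 y0 y1 y2) => //.
- by rewrite k_ge6.
- move=> T1 T2 sT1 /subsetP X12 sT2 /subsetP Y12 card_T.
  have [[_ a1u a2u] [_ ne_a _]] := ladder_end_neq lad_u.
  have [[_ b1v b2v] [_ ne_b _]] := ladder_end_neq lad_v.
  have x1T : x1 \in T1 by apply: X12; rewrite !inE eqxx.
  have x2T : x2 \in T1 by apply: X12; rewrite !inE eqxx orbT.
  have y1T : y1 \in T2 by apply: Y12; rewrite !inE eqxx.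
  have y2T : y2 \in T2 by apply: Y12; rewrite !inE eqxx orbT.
  have [C [kC eNC sTC]] := kcycle_across n_gt1 uv ends_e sT1 x1T x2T sT2 y1T y2T
    ax1 ax2 by1 by2 a1u a2u b1v b2v ne_a ne_b ab1 ab2.
  by apply: coverable1 eNC sTC; rewrite -card_T.
- move=> T sT /subsetP X01 k_bd.
  have [[a0u a1u _] [ne_a _ cu]] := ladder_end_neq lad_u.
  have [_ /andP[ac0 ac1] _] := lad_u.
  have x0T : x0 \in T by apply: X01; rewrite !inE eqxx.
  have x1T : x1 \in T by apply: X01; rewrite !inE eqxx orbT.
  have [C [kC eNC sTC]] := kcycle_handle n_gt1 uv ends_e sT x0T x1T
    ax0 ax1 a0u a1u ne_a cu ac0 ac1 k_bd.
  apply: coverable1 eNC sTC; move: kC; rewrite subnKC //.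
  by rewrite ltnW // -subn_gt0 ltnW //; case/andP: k_bd.
- move=> T sT /subsetP Y01 k_bd.
  have [[b0v b1v _] [ne_b _ dv]] := ladder_end_neq lad_v.
  have [_ /andP[bd0 bd1] _] := lad_v.
  have y0T : y0 \in T by apply: Y01; rewrite !inE eqxx.
  have y1T : y1 \in T by apply: Y01; rewrite !inE eqxx orbT.
  have [C [kC eNC sTC]] := kcycle_handle n_gt1 vu ends_e' sT y0T y1T
    by0 by1 b0v b1v ne_b dv bd0 bd1 k_bd.
  apply: coverable1 eNC sTC; move: kC; rewrite subnKC //.
  by rewrite ltnW // -subn_gt0 ltnW //; case/andP: k_bd.
Qed.

(** The vertex e is isolated in the rest of the network, which is therefore disconnected
    unless e is its only vertex. *)
Lemma coverable_structure_cut n (e : BCDC n) u v k m : 1 < n ->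
  (forall w, inc w e = (w == u) || (w == v)) ->
  coverable k e m (star u :\ e :|: star v :\ e) ->
  exists2 F : {set subgraph (BCDC n)}, structure_cut (cycle_graph k) F & #|F| <= m.
Proof.
move=> n_gt1 ends_e [F [card_F F_sub F_iso eN covered]]; exists F => //.
split=> //; split=> //.
pose e' : del_vertices (cover_vertices F) := exist _ e eN.
have [/forallP all_e|] := boolP [forall x : del_vertices (cover_vertices F), x == e'].
  by right; apply/eqP/fintype1P; exists e' => x; apply/eqP/all_e.
rewrite negb_forall => /existsP[x ne_x]; left; exists e', x.
apply/negP => /connectP[[|y p] /=]; first by move=> _ eq_x; rewrite eq_x eqxx in ne_x.
case/andP=> ey _ _; case/negP: (valP y); apply: (subsetP covered).
have : adj e (val y) by exact: ey.
rewrite BCDC_adjE // => /andP[ne_ey /existsP[w /andP[]]]; rewrite ends_e !inE.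
by rewrite [_ == e]eq_sym ne_ey => /orP[] /eqP-> ->; rewrite ?orbT.
Qed.

Theorem theorem4p15 (n k : nat) (hn : 5 <= n) (hk : 6 <= k <= 2 * n) :
  let r := (n - 1) %% k in
  is_structure_connectivity (BCDC n) (cycle_graph k)
    (if ((6 <= k <= n - 1) && (1 <= r <= k %/ 2 - 1)) || (k == 2 * n)
     then 2 * ceil_div (n - 1) k - 1
     else if k == n then 3
     else 2 * ceil_div (n - 1) k).
Proof.
move=> r; rewrite -[if _ then _ else _]/(cycle_number n k) {r}.
have n_gt1 : 1 < n by apply: leq_trans hn.
have n_gt3 : 3 < n by apply: ltnW.
have k_gt2 : 2 < k by case/andP: hk => /ltnW/ltnW/ltnW.
have lower (F : {set subgraph (BCDC n)}) :
    structure_cut (cycle_graph k) F -> cycle_number n k <= #|F|.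
  case=> [[F_sub F_cut] F_iso].
  have [[e eN nbrs]|large] := cut_isolates_or_large n_gt1 n_gt3 F_cut.
    have [u [v [uv ends_e]]] := edge_ends n_gt1 e.
    have sub : star u :\ e :|: star v :\ e \subset cover_vertices F.
      apply/subsetP => x; rewrite !inE -andb_orr => /andP[ne_xe x_uv].
      apply: nbrs; rewrite BCDC_adjE // eq_sym ne_xe; apply/existsP.
      by case/orP: x_uv => wx; [exists u|exists v]; rewrite ends_e wx eqxx ?orbT.
    have [a [b [c [-> count pure unmixed]]]] :=
      cover_count n_gt1 uv ends_e k_gt2 F_sub F_iso eN sub.
    exact: cycle_number_leq.
  apply: cycle_number_leq_large => //; apply: leq_trans large _.
  apply: leq_card_bigcup => S SF; have [f [f_inj -> _]] := F_iso S SF.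
  by rewrite card_imset // card_ord.
split=> //; have [e [u [v [uv ends_e cov]]]] := cycle_cover hn hk.
have [F F_cut card_F] := coverable_structure_cut n_gt1 ends_e cov.
by exists F => //; apply/eqP; rewrite eqn_leq card_F lower.
Qed.
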